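(* Let $n$ be an even positive integer, let $K$ be a field of characteristic different from $2$ containing a primitive $n$-th root of unity $\omega$, let $a,b\in K^{\times}$, let $S=(a,b;n,K,\omega)$ be the corresponding symbol algebra, and let $T_S$ be its quadratic trace form. Write $T_S\simeq q_S\perp m\times\mathbb{H}$ where $q_S\simeq\langle n\rangle\langle 1,a,b,(-1)^{\frac n2}ab\rangle$ and $m=\frac{n^2-4}{2}$. Let $k$ be an even integer. Then for $k>1$, $$S^kT_S=\begin{cases}\displaystyle\left(1+\frac{(m+3+k/2)(m+2+k/2)}{(k/2)(k/2-1)}\right)\binom{m+1+k/2}{k/2-2}\times\langle 1\rangle\perp\mathrm{Hyp},&\text{if }n\equiv 0\pmod 4;\\[3mm]\displaystyle\left(\frac{(m+3+k/2)(m+2+k/2)}{(k/2)(k/2-1)}-1\right)\binom{m+1+k/2}{k/2-2}\times\langle 1\rangle\perp\mathrm{Hyp},&\text{if }n\equiv 2\pmod 4.\end{cases}$$ Here $\mathrm{Hyp}$ denotes the orthogonal sum of the number of hyperbolic planes needed for the right-hand side to have dimension $\dim S^kT_S=\binom{n^2+k-1}{k}$, and equality of forms is understood up to isometry.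
   Context: $K$ is a field with $\mathrm{char}(K)\neq 2$, and symmetric bilinear forms over $K$ are identified with quadratic forms. $\langle a_1,\dots,a_m\rangle$ denotes the diagonal form with coefficients $a_i\in K^{\times}$. $\mathbb{H}=\langle 1,-1\rangle$ is the hyperbolic plane. For $r\ge 0$, $r\times\varphi$ denotes the orthogonal sum of $r$ copies of $\varphi$, whereas $\langle n\rangle\varphi$ denotes the tensor product of the one-dimensional form $\langle n\rangle$ with $\varphi$ (scaling by $n$). $\perp$ denotes orthogonal sum and $\simeq$ denotes isometry. (Non-factorial) symmetric power: for $\varphi\simeq\langle a_1,\dots,a_m\rangle$ and an integer $k\ge 0$, the $k$-fold symmetric power $S^k\varphi$ is the diagonal form on the $k$-th symmetric power $S^kV$ of the underlying space $V$ given by the orthogonal sum of the one-dimensional forms $\langle a_{i_1}^{k_{i_1}}\cdots a_{i_\ell}^{k_{i_\ell}}\rangle$ over all choices of indices $1\le i_1<\dots<i_\ell\le m$ and positive integers $k_{i_1},\dots,k_{i_\ell}$ with $k_{i_1}+\dots+k_{i_\ell}=k$. That is, there is one summand for each degree-$k$ monomial in $a_1,\dots,a_m$. In particular $S^0\varphi=\langle 1\rangle$, $S^1\varphi=\varphi$ and $\dim S^k\varphi=\binom{m+k-1}{k}$. Up to isometry $S^k\varphi$ depends only on the isometry class of $\varphi$. (In this paragraph $m$ denotes the dimension of $\varphi$, and is unrelated to the $m$ of the claim.) Symbol algebra: for $a,b\in K^{\times}$ and a primitive $n$-th root of unity $\omega\in K$, $(a,b;n,K,\omega)$ is the $K$-algebra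 generated by elements $x,y$ with $x^n=a$, $y^n=b$, $yx=\omega xy$. It is a central simple $K$-algebra of degree $n$ (dimension $n^2$). Trace form: for a central simple $K$-algebra $A$, $T_A\colon A\to K$ is the quadratic form $T_A(z)=\mathrm{Trd}_A(z^2)$, where $\mathrm{Trd}_A$ is the reduced trace of $A$. For $n$ even it is a known result that $T_S\simeq\langle n\rangle\langle 1,a,b,(-1)^{n/2}ab\rangle\perp\frac{n^2-4}{2}\times\mathbb{H}$.
   Formalization: For k=2 the displayed multiplicity is undefined (denominator (k/2)(k/2-1)=0 and binomial with lower entry -1); the formal statement takes it to be m+4, the value of binom(m+3+k/2, k/2) at k=2, and keeps the displayed formula for k≥4. *)

(* Defs.v *)
From HB Require Import structures.
From mathcomp Require Import all_boot all_order all_algebra all_field.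

Set Implicit Arguments.
Unset Strict Implicit.
Unset Printing Implicit Defensive.

Import GRing.Theory.
Local Open Scope ring_scope.

(** * Quadratic forms *)

(* Since char K != 2, symmetric bilinear forms are identified with quadratic
   forms, and a quadratic form on V is given as the function q : V -> K. *)
Definition isometric (K : fieldType) (V W : lmodType K)
    (q : V -> K) (q' : W -> K) : Prop :=
  exists f : {linear V -> W}, bijective f /\ forall v, q' (f v) = q v.

(* The diagonal form <d_1, ..., d_m>, for d = [:: d_1; ...; d_m]. In terms of
   lists of coefficients, the orthogonal sum is concatenation. *)
Definition diag_form (K : fieldType) (d : seq K) (v : 'rV[K]_(size d)) : K :=
  \sum_(i < size d) d`_i * v ord0 i ^+ 2.

Definition diagonalization (K : fieldType) (V : lmodType K)
    (q : V -> K) (d : seq K) : Prop :=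
  all (fun c => c != 0) d /\ isometric q (@diag_form K d).

(* r x <d> *)
Definition dcopies (K : fieldType) (r : nat) (d : seq K) : seq K :=
  flatten (nseq r d).

(* <c><d> *)
Definition dscale (K : fieldType) (c : K) (d : seq K) : seq K :=
  [seq c * x | x <- d].

Definition hyperbolic_plane (K : fieldType) : seq K := [:: 1; -1].

(* S^k <d_1, ..., d_m>: one coefficient for each monomial of degree k in
   d_1, ..., d_m. A monomial is given by its exponents e_1, ..., e_m, which are
   at most k; the indices i_1 < ... < i_l of the variables occurring in it are
   those at which e is positive. *)
Definition dsympow (K : fieldType) (k : nat) (d : seq K) : seq K :=
  [seq \prod_(i < size d) d`_i ^+ e i
     | e : {ffun 'I_(size d) -> 'I_k.+1} <- enum {: {ffun 'I_(size d) -> 'I_k.+1}}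
     & (\sum_i e i == k)%N].

(** * Symbol algebras and reduced traces *)

(* A is the algebra (a, b; n, K, w) with canonical generators x and y. The
   algebra presented by these generators and relations is simple when w is a
   primitive n-th root of unity and a, b != 0, hence it is isomorphic to any
   nonzero algebra generated by elements satisfying the relations. *)
Record symbol_algebra (K : fieldType) (n : nat) (w a b : K)
    (A : falgType K) (x y : A) : Prop := SymbolAlgebra {
  symbol_xn : x ^+ n = a%:A;
  symbol_yn : y ^+ n = b%:A;
  symbol_yx : y * x = w *: (x * y);
  symbol_gen : agenv <<[:: x; y]>>%VS = {:A}%VS
}.

(* rho : A -> M_d(L) is a splitting of A over the extension iota : K -> L: it
   is a K-algebra morphism whose L-linear extension L (x) A -> M_d(L) is an
   isomorphism, i.e., it maps a K-basis of A to an L-basis of M_d(L). *)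
Definition splitting (K : fieldType) (A : falgType K) (L : fieldType)
    (iota : {rmorphism K -> L}) (d : nat)
    (rho : {rmorphism A -> 'M[L]_d}) : Prop :=
  (forall (c : K) (z : A), rho (c *: z) = iota c *: rho z) /\
  basis_of {:'M[L]_d}%VS [seq rho z | z <- vbasis {:A}%VS].

(* The value of \tr (rho z) does not depend on the choice of the splitting. *)
Definition reduced_trace (K : fieldType) (A : falgType K) (Trd : A -> K) :
    Prop :=
  exists (L : fieldType) (iota : {rmorphism K -> L}) (d : nat)
         (rho : {rmorphism A -> 'M[L]_d}),
    splitting iota rho /\ forall z, iota (Trd z) = \tr (rho z).

Definition trace_form (K : fieldType) (A : falgType K) (Trd : A -> K) (z : A) :
  K := Trd (z ^+ 2).

(** * Multiplicities *)

(* With j = k / 2, the number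
     (1 +- (m+3+j)(m+2+j) / (j(j-1))) * binom(m+1+j, j-2),
   where the sign is attached to the term 1. For j = 1 the formula reads
   "m+4 over 0" times binom(m+2, -1) = 0; since
     (m+3+j)(m+2+j) / (j(j-1)) * binom(m+1+j, j-2) = binom(m+3+j, j)
   for j >= 2, its value at j = 1 is understood as binom(m+4, 1) +- 0 = m+4.
   This case is separate because x / 0 = 0 and 1 - 2 = 0 in nat would give a
   meaningless value. *)
Definition sympow_ratio (m k : nat) : rat :=
  let j : rat := k%:R / 2%:R in
  (m%:R + 3%:R + j) * (m%:R + 2%:R + j) / (j * (j - 1)).

Definition sympow_mult (n m k : nat) : rat :=
  if k == 2 then m%:R + 4%:R
  else if (n %% 4 == 0)%N
  then (1 + sympow_ratio m k) * 'C(m + 1 + k./2, k./2 - 2)%:R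
  else (sympow_ratio m k - 1) * 'C(m + 1 + k./2, k./2 - 2)%:R.

(* Main.v *)
From HB Require Import structures.
Require Import Defs.
From mathcomp Require Import all_boot all_order all_algebra all_field.
From mathcomp Require Import zify ring.

Import GRing.Theory.
Local Open Scope ring_scope.

Set Implicit Arguments.
Unset Strict Implicit.
Unset Printing Implicit Defensive.

(** Trace form. In S, conjugation by y multiplies x ^+ i * y ^+ j by w ^+ i, and
    conjugation by x multiplies it by a power of w governed by j. A trace is
    invariant under conjugation, so the reduced trace kills every such monomial
    except those with n dividing i and j ([trd_monomial_eq0]). Hence, for the
    bilinear form Trd (u * v), the monomial of exponents (i, j) is orthogonal to
    all the others but the one of exponents (- i, - j) modulo n. The involution
    (i, j) -> (- i, - j) fixes four points, which give the four coefficients of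
    q_S, and its two-element orbits give hyperbolic planes
    ([involution_orthogonal], [trace_form_diagonalization]). The orthogonal
    family so obtained has n ^ 2 members, which proves that S has dimension
    n ^ 2 and that Trd 1 = n.

    Symmetric powers. Two diagonalizations of one form are linked by changes of
    one or two coefficients at a time: this is Witt's chain equivalence theorem
    ([chain_congruent]), whose proof rests on Witt cancellation
    ([congruent_cancel]). Formally 1 / (1 - c t) = (1 + c t) / (1 - c^2 t^2),
    and c^2 is a square, so up to isometry the generating series of the
    symmetric powers of a form of dimension N is that of its exterior powers
    divided by (1 - t^2)^N ([sympow_extpow]). Exterior powers are visibly
    unchanged by the moves on one or two coefficients, so symmetric powers are
    invariants of the form ([chain_sympow]).

    Computation. A hyperbolic plane <1, -1> contributes
    1 / ((1 - t) (1 + t)) = 1 / (1 - t^2) to the series, up to hyperbolic planes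
    ([sympow_hyperbolic_plane]). For q_S, the second exterior power is
    hyperbolic and the fourth is <1> or <-1>, according to the sign
    (-1) ^ (n / 2). The coefficient of t^(2 j) in
    (1 +- t^4) / (1 - t^2)^(m + 4) is then the number of copies of <1>, namely
    'C(m + 3 + j, m + 3) +- 'C(m + 1 + j, m + 3) ([sympow_quaternary]). When n is divisible by 4, a power of w
    is a square root of -1; this is what makes the second exterior power
    hyperbolic in that case ([neg_root_square]). *)

(** Abstracts the terms that count elements of K, which [lia] would otherwise
    try to interpret. *)
Ltac nat_atoms :=
  repeat match goal with |- context [count ?P ?s] => move: (count P s) => ? end;
  repeat match goal with |- context [nat_of_bool ?b] =>
    move: (nat_of_bool b) => ? end.

(** * Chain equivalence of diagonal forms *)

Section Chain.
Variable K : fieldType.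
Implicit Types (a b c t u v : K) (d e f : seq K).

(** The binary move replaces the plane <a, b> by a plane that represents c and
    has the same discriminant, which determines it up to isometry. *)
Inductive chain : seq K -> seq K -> Prop :=
| chain_refl d : chain d d
| chain_sym d e : chain d e -> chain e d
| chain_trans e d f : chain d e -> chain e f -> chain d f
| chain_cons c d e : chain d e -> chain (c :: d) (c :: e)
| chain_square a u d : u != 0 -> chain (a :: d) (a * u ^+ 2 :: d)
| chain_binary a b u v c d : a * u ^+ 2 + b * v ^+ 2 = c -> c != 0 ->
    chain (a :: b :: d) (c :: a * b * c :: d).

Lemma chain_size d e : chain d e -> size d = size e.
Proof. by elim=> //= [? ? ? _ -> _ -> | ? ? ? _ ->]. Qed.

Lemma chain_neq0 d e : chain d e ->
  all (fun c => c != 0) d = all (fun c => c != 0) e.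
Proof.
elim=> //= [? ? ? _ -> _ -> // | ? ? ? _ -> // | a u ? u0 | a b u v c ? _ c0].
  by rewrite mulf_eq0 sqrf_eq0 (negPf u0) orbF.
by rewrite c0 /= !mulf_eq0 (negPf c0) orbF negb_or andbA.
Qed.

Lemma chain_eq d e : d = e -> chain d e.
Proof. by move->; apply: chain_refl. Qed.

Lemma chain_cat2l f d e : chain d e -> chain (f ++ d) (f ++ e).
Proof. by move=> de; elim: f => //= c f; apply: chain_cons. Qed.

Lemma chain_cat2r f d e : chain d e -> chain (d ++ f) (e ++ f).
Proof.
elim=> {d e} [d | d e _ | d e g _ IHd _ | c d e _ | a u d u0
             | a b u v c d cE c0] /=.
- exact: chain_refl.
- exact: chain_sym.
- exact: chain_trans.
- exact: chain_cons.
- exact: chain_square.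
- exact: chain_binary cE c0.
Qed.

Lemma chain_cat d d' e e' :
  chain d d' -> chain e e' -> chain (d ++ e) (d' ++ e').
Proof.
by move=> dd' ee'; apply: chain_trans (chain_cat2r _ dd') (chain_cat2l _ ee').
Qed.

(** The binary move with (u, v) = (0, 1) exchanges two coefficients, up to a
    square. It needs the incoming coefficient to be nonzero. *)
Lemma chain_swap a b d : chain (a :: b :: d) (b :: a :: d).
Proof.
have swap b' a' : b' != 0 -> chain (a' :: b' :: d) (b' :: a' :: d).
  move=> b0; apply: (chain_trans (e := b' :: a' * b' ^+ 2 :: d)).
    rewrite expr2 mulrA; apply: (@chain_binary _ _ 0 1) => //; ring.
  by apply/chain_cons/chain_sym/chain_square.
have [b0|] := eqVneq b 0; last exact: swap.
have [a0|a0] := eqVneq a 0; last by apply/chain_sym/swap.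
by rewrite a0 b0; apply: chain_refl.
Qed.

Lemma chain_perm d e : perm_eq d e -> chain d e.
Proof.
elim: d e => [|c d IH] e.
  by rewrite perm_sym => /perm_nilP->; apply: chain_refl.
move=> /[dup] /perm_mem/(_ c); rewrite mem_head => /esym/[swap].
move=> + /[dup] /splitPr => /[swap] -[e1 e2] + _.
rewrite perm_sym -cat1s perm_catCA /= perm_cons perm_sym => /IH de.
apply: (chain_trans (chain_cons c de)).
elim: e1 {de} => [|a e1 IHe] /=; first exact: chain_refl.
by apply: chain_trans (chain_swap _ _ _) _; apply: chain_cons.
Qed.

Lemma chain_scale t d e : chain d e -> chain (dscale t d) (dscale t e).
Proof.
have [->|t0] := eqVneq t 0 => de.
  apply: chain_eq; apply: (eq_from_nth (x0 := 0)).
    by rewrite !size_map (chain_size de).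
  move=> i; rewrite size_map => id; rewrite !(nth_map 0) ?mul0r //.
  by rewrite -(chain_size de).
rewrite /dscale; elim: de => {d e} /= [d | d e _ | e d f _ IHd _ | c d e _ | a u d u0
       | a b u v c d cE c0] /=.
- exact: chain_refl.
- exact: chain_sym.
- exact: chain_trans.
- exact: chain_cons.
- by rewrite mulrA; apply: chain_square.
(* the discriminant is scaled by t ^+ 2, hence the correction by this square *)
apply: (chain_trans (e := t * c :: (t * (a * b * c)) * t ^+ 2 :: map ( *%R t) d)).
  have -> : t * (a * b * c) * t ^+ 2 = (t * a) * (t * b) * (t * c) by ring.
  apply: (@chain_binary _ _ u v); last by rewrite mulf_neq0.
  by rewrite -cE; ring.
by apply/chain_cons/chain_sym/chain_square.
Qed.

Lemma dscale_cat t d e : dscale t (d ++ e) = dscale t d ++ dscale t e.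
Proof. exact: map_cat. Qed.

Lemma dscale_dscale t u d : dscale t (dscale u d) = dscale (t * u) d.
Proof. by rewrite /dscale -map_comp; apply: eq_map => x /=; rewrite mulrA. Qed.

Lemma dscale1 d : dscale 1 d = d.
Proof. by rewrite /dscale -[RHS]map_id; apply: eq_map => x; rewrite mul1r. Qed.

Lemma chain_dscale_square t u d : u != 0 ->
  chain (dscale (t * u ^+ 2) d) (dscale t d).
Proof.
move=> u0; elim: d => [|c d IH] /=; first exact: chain_refl.
apply: chain_trans (chain_cons _ IH) _; rewrite mulrAC.
exact/chain_sym/chain_square.
Qed.

Lemma chain_dscale_binary a b u v c d : a * u ^+ 2 + b * v ^+ 2 = c -> c != 0 ->
  chain (dscale a d ++ dscale b d) (dscale c d ++ dscale (a * b * c) d).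
Proof.
move=> cE c0.
have perm2 x y z e : chain (dscale x (z :: e) ++ dscale y (z :: e))
    (dscale z [:: x; y] ++ (dscale x e ++ dscale y e)).
  apply/chain_perm/permP => P; rewrite /dscale !(count_cat, map_cat) /=.
  by rewrite [z * x]mulrC [z * y]mulrC; nat_atoms; lia.
elim: d => [|z d IH]; first exact: chain_refl.
apply: chain_trans (perm2 _ _ _ _) _; apply: chain_sym.
apply: chain_trans (perm2 _ _ _ _) _; apply: chain_sym.
by apply: chain_cat IH; apply/chain_scale/chain_binary/c0/cE.
Qed.

End Chain.

(** * Congruence of diagonal Gram matrices *)
Section Congruence.
Variable K : fieldType.
Implicit Types (a b c t u v : K) (d e f : seq K).

Definition gram d : 'M[K]_(size d) := diag_mx (\row_i d`_i).

(** P is square only up to a provable equality of size d and size e, whence the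
    explicit inverse Q in place of [unitmx]. *)
Definition congruent d e : Prop :=
  exists (P : 'M_(size d, size e)) (Q : 'M_(size e, size d)),
    [/\ P *m Q = 1%:M, Q *m P = 1%:M & P *m gram e *m P^T = gram d].

Lemma mulmx_diag_form d e (P : 'M_(size e, size d)) i j :
  (P *m gram d *m P^T) i j = \sum_(k < size d) d`_k * (P i k * P j k).
Proof.
rewrite mxE; apply: eq_bigr => k _.
by rewrite /gram mul_mx_diag !mxE mulrAC mulrC mulrA.
Qed.

Lemma diag_formE d (v : 'rV_(size d)) :
  diag_form v = (v *m gram d *m v^T) 0 0.
Proof.
rewrite mxE; apply: eq_bigr => k _.
by rewrite /gram mul_mx_diag !mxE mulrAC mulrC expr2.
Qed.

Lemma congruent_refl d : congruent d d.
Proof. by exists 1%:M, 1%:M; rewrite trmx1 !mulmx1 mul1mx. Qed.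

Lemma congruent_sym d e : congruent d e -> congruent e d.
Proof.
case=> P [Q [PQ QP PP]]; exists Q, P; split=> //.
by rewrite -PP !mulmxA QP mul1mx -mulmxA -trmx_mul QP trmx1 mulmx1.
Qed.

Lemma congruent_trans d e f : congruent d e -> congruent e f -> congruent d f.
Proof.
case=> P [Q [PQ QP PP]] [P' [Q' [PQ' QP' PP']]].
exists (P *m P'), (Q' *m Q); split.
- by rewrite mulmxA -(mulmxA P) PQ' mulmx1.
- by rewrite mulmxA -(mulmxA Q') QP mulmx1.
by rewrite -PP -PP' trmx_mul !mulmxA.
Qed.

Lemma gram_cons c d :
  gram (c :: d) = block_mx c%:M 0 0 (gram d) :> 'M_(1 + size d).
Proof.
rewrite /gram -diag_const_mx -diag_mx_row; congr diag_mx.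
apply/rowP=> i; rewrite !mxE.
by case: splitP => j ->; rewrite !mxE /= ?ord1.
Qed.

Lemma gram_cons2 a b d :
  gram (a :: b :: d) = block_mx (block_mx a%:M 0 0 b%:M) 0 0 (gram d)
    :> 'M_((1 + 1) + size d).
Proof.
rewrite /gram -!diag_const_mx -!diag_mx_row; congr diag_mx.
apply/rowP=> i; rewrite !mxE.
case: splitP => j ->; rewrite !mxE //.
by case: splitP => k ->; rewrite !mxE /= ?ord1.
Qed.

Lemma congruent_block k m n (P Q D : 'M[K]_k)
    (P' : 'M_(m, n)) (Q' : 'M_(n, m)) D' :
    P *m Q = 1%:M -> Q *m P = 1%:M -> P' *m Q' = 1%:M -> Q' *m P' = 1%:M ->
  let R := block_mx P 0 0 P' in let S := block_mx Q 0 0 Q' in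
  [/\ R *m S = 1%:M, S *m R = 1%:M
    & R *m block_mx D 0 0 D' *m R^T =
      block_mx (P *m D *m P^T) 0 0 (P' *m D' *m P'^T)].
Proof.
move=> PQ QP PQ' QP'; rewrite /= !(mulmx_block, tr_block_mx).
rewrite !(mulmx0, mul0mx, addr0, add0r, trmx0) PQ QP PQ' QP'.
by rewrite -!scalar_mx_block.
Qed.

Lemma congruent_cons c d e : congruent d e -> congruent (c :: d) (c :: e).
Proof.
case=> P [Q [PQ QP PP]].
have [] := congruent_block (c%:M : 'M_1) (gram e)
  (mul1mx 1%:M) (mul1mx 1%:M) PQ QP.
rewrite mul1mx trmx1 mulmx1 PP => RS SR RR.
do 2 eexists; split; [exact: RS | exact: SR | ].
by rewrite !gram_cons; apply: RR.
Qed.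

Lemma congruent_square a u d : u != 0 -> congruent (a :: d) (a * u ^+ 2 :: d).
Proof.
move=> u0.
have uV : u^-1%:M *m u%:M = 1%:M :> 'M[K]_1 by rewrite -scalar_mxM mulVf.
have Vu : u%:M *m u^-1%:M = 1%:M :> 'M[K]_1 by rewrite -scalar_mxM mulfV.
have [] := congruent_block (a * u ^+ 2)%:M (gram d) uV Vu
  (mul1mx 1%:M) (mul1mx 1%:M).
rewrite tr_scalar_mx -!scalar_mxM mul1mx trmx1 mulmx1.
have -> : u^-1 * (a * u ^+ 2) * u^-1 = a by field.
move=> RS SR RR.
do 2 eexists; split; [exact: RS | exact: SR | ].
by rewrite !gram_cons; apply: RR.
Qed.

Lemma congruent_binary a b u v c d : a * u ^+ 2 + b * v ^+ 2 = c -> c != 0 ->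
  congruent (a :: b :: d) (c :: a * b * c :: d).
Proof.
move=> cE c0; apply: congruent_sym.
(* the second row is orthogonal to (u, v) for the form <a, b> *)
pose R : 'M[K]_(1 + 1) := block_mx u%:M v%:M (- (b * v))%:M (a * u)%:M.
pose S : 'M[K]_(1 + 1) :=
  block_mx (a * u / c)%:M (- v / c)%:M (b * v / c)%:M (u / c)%:M.
have RS : R *m S = 1%:M.
  rewrite mulmx_block -!scalar_mxM -!raddfD /=.
  by rewrite (scalar_mx_block 1 1 1) -(raddf0 (@scalar_mx K 1)); congr block_mx;
    congr _%:M; rewrite -cE in c0 *; field.
have [] := congruent_block (block_mx a%:M 0 0 b%:M) (gram d) RS (mulmx1C RS)
  (mul1mx 1%:M) (mul1mx 1%:M).
have -> : R *m block_mx a%:M 0 0 b%:M *m R^T = block_mx c%:M 0 0 (a * b * c)%:M.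
  rewrite tr_block_mx !mulmx_block !tr_scalar_mx -(raddf0 (@scalar_mx K 1)).
  rewrite -!scalar_mxM -!raddfD /= -!scalar_mxM -!raddfD /= -cE.
  by congr block_mx; congr _%:M; ring.
rewrite mul1mx trmx1 mulmx1 => RS' SR' RR.
do 2 eexists; split; [exact: RS' | exact: SR' | ].
by rewrite !gram_cons2; apply: RR.
Qed.

Lemma congruent_chain d e : chain d e -> congruent d e.
Proof.
elim=> {d e} [d | d e _ | d e f _ IHd _ | c d e _ | a u d u0
             | a b u v c d cE c0].
- exact: congruent_refl.
- exact: congruent_sym.
- exact: congruent_trans.
- exact: congruent_cons.
- exact: congruent_square.
- exact: congruent_binary cE c0.
Qed.

Lemma isometric_congruent d e :
  congruent d e -> isometric (diag_form (d := d)) (diag_form (d := e)).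
Proof.
case=> P [Q [PQ QP PP]]; exists (mulmxr P); split=> [|v] /=.
  by exists (mulmxr Q) => v /=; rewrite -mulmxA ?PQ ?QP mulmx1.
by rewrite !diag_formE -PP trmx_mul !mulmxA.
Qed.

End Congruence.

(** * Witt cancellation and the chain equivalence theorem *)
Section Witt.
Variable K : fieldType.
Hypothesis two_neq0 : 2%:R != 0 :> K.
Implicit Types (a b c t u v : K) (d e f : seq K).

(** Polarization: evaluate the form at the sum of two basis vectors. *)
Lemma sym_form_eq0 n (G : 'M[K]_n) : G^T = G ->
  (forall v : 'rV_n, (v *m G *m v^T) 0 0 = 0) -> G = 0.
Proof.
move=> Gsym G0.
have entry i j : ((delta_mx 0 i : 'rV_n) *m G *m (delta_mx 0 j : 'rV_n)^T) 0 0 = G i j.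
  by rewrite -rowE trmx_delta -colE !mxE.
have addE (A B : 'M[K]_1) : (A + B) 0 0 = A 0 0 + B 0 0 by rewrite mxE.
have diag0 i : G i i = 0 by rewrite -entry.
apply/matrixP=> i j; rewrite mxE.
have := G0 (delta_mx 0 i + delta_mx 0 j).
rewrite linearD /= !(mulmxDl, mulmxDr) !addE !entry !diag0.
have -> : G j i = G i j by rewrite -{1}Gsym mxE.
rewrite add0r addr0 => /eqP.
by rewrite -mulr2n -mulr_natl mulf_eq0 (negPf two_neq0) => /eqP.
Qed.

(** The matrix that passes from one coordinate system to the other is a
    congruence, because a symmetric matrix is determined by its quadratic form. *)
Lemma diagonalization_congruent (V : lmodType K) (q : V -> K) d e :
  isometric q (diag_form (d := d)) -> isometric q (diag_form (d := e)) ->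
  congruent d e.
Proof.
move=> [f [[f' fK f'K] qf]] [g [[g' gK g'K] qg]].
pose change m n (h : V -> 'rV[K]_n) (k' : 'rV[K]_m -> V) : 'M[K]_(m, n) :=
  \matrix_i h (k' (delta_mx 0 i)).
have changeP m n (h : {linear V -> 'rV[K]_n}) (k : {linear V -> 'rV[K]_m}) k' z :
    cancel k k' -> cancel k' k -> k z *m change m n h k' = h z.
  move=> kK k'K.
  have {2}-> : z = \sum_i k z 0 i *: k' (delta_mx 0 i).
    apply: (can_inj kK); rewrite linear_sum {1}[k z]row_sum_delta.
    by apply: eq_bigr => i _; rewrite linearZ /= k'K.
  rewrite linear_sum mulmx_sum_row; apply: eq_bigr => i _.
  by rewrite linearZ rowK.
have fg z := changeP _ _ f g g' z gK g'K.
have gf z := changeP _ _ g f f' z fK f'K.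
exists (change _ _ g f'), (change _ _ f g'); split.
- apply/row_matrixP=> i; rewrite !rowE mulmxA mulmx1 -{1}[delta_mx 0 i]f'K.
  by rewrite gf fg f'K.
- apply/row_matrixP=> i; rewrite !rowE mulmxA mulmx1 -{1}[delta_mx 0 i]g'K.
  by rewrite fg gf g'K.
apply/eqP; rewrite -subr_eq0; apply/eqP/sym_form_eq0.
  by rewrite linearB /= !trmx_mul !tr_diag_mx trmxK mulmxA.
move=> v; rewrite mulmxBr mulmxBl mxE [X in _ + X]mxE -[v]f'K.
by rewrite !mulmxA gf -mulmxA -trmx_mul gf -!diag_formE qf qg subrr.
Qed.

Lemma mulmx1C_eq m n (P : 'M[K]_(m, n)) (Q : 'M_(n, m)) :
  m = n -> P *m Q = 1%:M -> Q *m P = 1%:M.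
Proof. by move=> mn; case: n / mn P Q => P Q; apply: mulmx1C. Qed.

(** Witt cancellation for a one-dimensional summand <c>. If the first row of P
    is (p, u), its first column (p, v) and Q its last block, then u E u^T and
    Q E u^T are multiples of 1 and v, so correcting Q by a multiple of v u changes
    Q E Q^T = D - c v v^T by a multiple of v v^T only. *)
Lemma cancel_block m n c (D : 'M[K]_m) (E : 'M[K]_n) (P : 'M_(1 + m, 1 + n)) :
  E^T = E ->
  P *m block_mx c%:M 0 0 E *m P^T = block_mx c%:M 0 0 D ->
  exists P' : 'M_(m, n), P' *m E *m P'^T = D.
Proof.
move=> Esym; rewrite -(submxK P).
move: (ulsubmx P) (ursubmx P) (dlsubmx P) (drsubmx P) => p u v Q.
rewrite (mx11_scalar p); move: (p 0 0) => {}p.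
rewrite tr_block_mx !mulmx_block !(mulmx0, addr0, add0r).
rewrite tr_scalar_mx -!scalar_mxM => /eq_block_mx[E1 _ E2 E3].
(* The equation says that Q - s v u carries E to D. Its roots are
   (p + 1)^-1 and (p - 1)^-1, one of which exists as 1 != -1. *)
have [s sE] : exists s, s ^+ 2 * (1 - p ^+ 2) + s * p *+ 2 = 1.
  have [p1|p1] := eqVneq (p + 1) 0; last by exists (p + 1)^-1; field.
  have -> : p = -1 by apply/eqP; rewrite -subr_eq0 opprK p1.
  by exists (- 2%:R^-1); field.
exists (Q - s *: (v *m u)).
have {}E1 : u *m E *m u^T = (c * (1 - p ^+ 2))%:M.
  by apply: (addrI (p * c * p)%:M); rewrite E1 -raddfD; congr _%:M; ring.
have {}E2 : Q *m E *m u^T = - (c * p) *: v.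
  apply: (addrI (v *m c%:M *m p%:M)); rewrite E2 -mulmxA -scalar_mxM mul_mx_scalar.
  by rewrite scaleNr subrr.
have E2T : u *m E *m Q^T = - (c * p) *: v^T.
  by apply: trmx_inj; rewrite !trmx_mul trmxK Esym mulmxA E2 linearZ /= trmxK.
have {}E3 : Q *m E *m Q^T = D - c *: (v *m v^T).
  by rewrite -E3 mul_mx_scalar -scalemxAl addrAC subrr add0r.
have -> : (Q - s *: (v *m u))^T = Q^T - s *: (u^T *m v^T).
  by rewrite linearB linearZ /= trmx_mul.
have T1 : s *: (v *m u) *m E *m Q^T = - (s * c * p) *: (v *m v^T).
  rewrite -!scalemxAl -!mulmxA [u *m _]mulmxA E2T.
  by rewrite -scalemxAr scalerA; congr (_ *: _); ring.
have T2 : Q *m E *m (s *: (u^T *m v^T)) = - (s * c * p) *: (v *m v^T).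
  rewrite -scalemxAr mulmxA E2 -scalemxAl scalerA; congr (_ *: _); ring.
have T3 : s *: (v *m u) *m E *m (s *: (u^T *m v^T)) =
    (s ^+ 2 * c * (1 - p ^+ 2)) *: (v *m v^T).
  rewrite -!scalemxAl -scalemxAr scalerA mulmxA -!(mulmxA v) E1.
  by rewrite mul_scalar_mx -scalemxAr scalerA; congr (_ *: _); ring.
rewrite !(mulmxBl, mulmxBr) T1 T2 T3 E3.
rewrite opprB -!addrA -[RHS]addr0; congr (_ + _).
rewrite -!scaleNr -!scalerDl -[RHS](scale0r (v *m v^T)); congr (_ *: _).
rewrite -[X in X + _]mulN1r -{1}sE; ring.
Qed.

Lemma gram_unit d : all (fun x => x != 0) d ->
  gram d *m diag_mx (\row_i (d`_i)^-1) = 1%:M.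
Proof.
move=> d0; rewrite mulmx_diag -diag_const_mx; congr diag_mx.
by apply/rowP=> i; rewrite !mxE mulfV //; apply: (all_nthP _ d0).
Qed.

Lemma congruent_cancel c d e :
  all (fun x => x != 0) d -> congruent (c :: d) (c :: e) -> congruent d e.
Proof.
move=> d0 [P [Q [PQ QP]]]; rewrite !gram_cons => PP.
have [R RR] := cancel_block (tr_diag_mx _) PP.
have R1 : R *m (gram e *m R^T *m diag_mx (\row_i (d`_i)^-1)) = 1%:M.
  by rewrite !mulmxA RR gram_unit.
exists R; eexists; split=> //; [exact: R1 | apply: mulmx1C_eq R1].
by apply: succn_inj; apply/eqP; rewrite eqn_leq (mulmx1_min PQ) (mulmx1_min QP).
Qed.

(** A nonzero value c = a (v 0)^2 + c' can be brought to the front: first bring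
    the value c' of the tail to its front, then use one binary move on a, c'. *)
Lemma represents_chain d (v : 'I_(size d) -> K) :
  \sum_(i < size d) d`_i * v i ^+ 2 != 0 ->
  exists e, chain d (\sum_(i < size d) d`_i * v i ^+ 2 :: e).
Proof.
elim: d v => [|a d IH] v; first by rewrite big_ord0 eqxx.
rewrite /= big_ord_recl /=; set c := \sum_(i < _) _ => c0.
have [cz|cnz] := eqVneq c 0.
  rewrite cz addr0 in c0 *; exists d; apply: chain_square.
  by apply: contraNneq c0 => ->; rewrite expr0n mulr0.
have [e de] := IH (fun i => v (lift ord0 i)) cnz.
exists (a * c * (a * v ord0 ^+ 2 + c) :: e).
apply: chain_trans (chain_cons _ de) _.
by apply: (@chain_binary _ _ _ (v ord0) 1) => //; rewrite expr1n mulr1.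
Qed.

(** Witt's chain equivalence theorem. The first coefficient of d is a value of e,
    so it can be brought to the front of e and cancelled. *)
Lemma chain_congruent d e :
  all (fun c => c != 0) d -> all (fun c => c != 0) e ->
  congruent d e -> chain d e.
Proof.
elim: d e => [|c d IH] e d0 e0.
  case=> P [Q [_ QP _]]; have := mulmx1_min QP; rewrite leqn0 => /nilP->.
  exact: chain_refl.
move=> cde; case: (cde) => P [Q [PQ QP PP]].
have cE : \sum_(i < size e) e`_i * P (@ord0 (size d)) i ^+ 2 = c.
  have := mulmx_diag_form P (@ord0 (size d)) (@ord0 (size d)).
  by rewrite PP /gram !mxE /= mulr1n => ->.
have := @represents_chain e (fun i => P (@ord0 (size d)) i).
rewrite cE; have /andP[c0 d0'] := d0 => /(_ c0) [e' ee'].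
apply: chain_sym; apply: (chain_trans ee'); apply/chain_sym/chain_cons/IH => //.
  by move: e0; rewrite (chain_neq0 ee') => /andP[].
by apply: congruent_cancel d0' _; apply: congruent_trans cde (congruent_chain ee').
Qed.

End Witt.

(** * Monomials and symmetric powers *)
Section Sympow.
Variable K : fieldType.
Implicit Types (a b c t u v : K) (d e f : seq K) (F G : nat -> seq K).

Fixpoint expvecs N k : seq (seq nat) :=
  if N is N'.+1 then [seq i :: w | i <- iota 0 k.+1, w <- expvecs N' (k - i)%N]
  else if k is 0 then [:: [::]] else [::].

Arguments expvecs : simpl never.

Lemma expvecsS N k :
  expvecs N.+1 k = [seq i :: w | i <- iota 0 k.+1, w <- expvecs N (k - i)%N].
Proof. by []. Qed.

Lemma mem_expvecs N k (e : seq nat) :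
  (e \in expvecs N k) = (size e == N) && (sumn e == k).
Proof.
elim: N k e => [|N IH] k e; first by case: k e => [|k] [].
rewrite expvecsS; apply/allpairsPdep/idP => [[i [e' [+ + ->]]]|].
  by rewrite mem_iota IH /= eqSS => ik /andP[-> /eqP->] /=; apply/eqP; lia.
case: e => [//|i e] /andP[/eqP[Ne] /eqP/= ke]; exists i, e.
split=> //; first by rewrite (mem_iota 0 k.+1); lia.
by rewrite IH Ne eqxx /=; apply/eqP; lia.
Qed.

Lemma uniq_expvecs N k : uniq (expvecs N k).
Proof.
elim: N k => [|N IH] k; first by case: k.
rewrite expvecsS; apply: allpairs_uniq_dep; rewrite ?iota_uniq //.
by move=> [i e] [j f] _ _ /= [-> ->].
Qed.

Lemma size_expvecs N k : size (expvecs N.+1 k) = 'C(N + k, N).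
Proof.
elim: N k => [|N IH] k.
  rewrite bin0 (perm_size (_ : perm_eq _ [:: [:: k]])) //.
  apply: uniq_perm; rewrite ?uniq_expvecs // => -[|i [|j e]]; rewrite mem_expvecs inE //=.
  - by rewrite addn0 eqseq_cons andbT.
  by rewrite eqseq_cons andbF.
have -> : size (expvecs N.+2 k) = (\sum_(i < k.+1) size (expvecs N.+1 i))%N.
  rewrite expvecsS size_allpairs_dep sumnE big_map -{1}[k.+1]subn0 -/(index_iota _ _).
  by rewrite big_mkord (reindex_inj rev_ord_inj) /=; apply: eq_bigr => i _;
    congr (size (expvecs _ _)); case: i => /= i; lia.
elim: k => [|k IHk]; first by rewrite big_ord_recl big_ord0 IH /= !addn0 !binn.
by rewrite big_ord_recr /= IHk IH !addSn !addnS [in RHS]binS.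
Qed.

Definition monomial d (e : seq nat) : K := \prod_(p <- zip d e) p.1 ^+ p.2.

Definition sympow d k : seq K := [seq monomial d w | w <- expvecs (size d) k].

Lemma monomialE d (e : seq nat) : size e = size d ->
  monomial d e = \prod_(i < size d) d`_i ^+ nth 0%N e i.
Proof.
move=> de; rewrite /monomial (big_nth (0, 0%N)) big_mkord size_zip de minnn.
by apply: eq_bigr => i _; rewrite nth_zip.
Qed.

(** The list of exponent vectors allows a recursion on d, which finite functions
    on [size d] points do not. *)
Lemma perm_dsympow k d : perm_eq (dsympow k d) (sympow d k).
Proof.
pose vec (e : {ffun 'I_(size d) -> 'I_k.+1}) :=
  [seq val (e i) | i <- enum 'I_(size d)].
have size_vec g : size (vec g) = size d by rewrite size_map size_enum_ord.
have nth_vec g (i : 'I_(size d)) : nth 0%N (vec g) i = g i.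
  by rewrite (nth_map i) ?size_enum_ord // nth_ord_enum.
have sum_vec g : sumn (vec g) = (\sum_i g i)%N by rewrite sumnE big_map big_enum.
have vec_inj : injective vec.
  by move=> g h gh; apply/ffunP => i; apply: val_inj; rewrite /= -!nth_vec gh.
rewrite /dsympow; set E := [seq e <- _ | _].
have -> : [seq \prod_(i < size d) d`_i ^+ e i | e : {ffun 'I_(size d) -> 'I_k.+1} <- E]
  = [seq monomial d w | w <- map vec E].
  rewrite -map_comp; apply: eq_map => e /=; rewrite monomialE //.
  by apply: eq_bigr => i _; rewrite nth_vec.
apply/perm_map/uniq_perm; rewrite ?uniq_expvecs //.
  by rewrite map_inj_uniq // filter_uniq // enum_uniq.
move=> e; rewrite mem_expvecs; apply/mapP/andP => [[g]|[/eqP de /eqP ke]].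
  by rewrite mem_filter => /andP[gk _] ->; rewrite size_vec sum_vec.
have le_ek (i : 'I_(size d)) : (nth 0%N e i < k.+1)%N.
  have ie : (i < size e)%N by rewrite de.
  rewrite -ke ltnS -{2}(cat_take_drop i e) (drop_nth 0%N) // sumn_cat /=; lia.
have vecE : vec [ffun i => Ordinal (le_ek i)] = e.
  apply: (eq_from_nth (x0 := 0%N)) => [|i]; rewrite size_vec // => id.
  by rewrite (nth_vec _ (Ordinal id)) ffunE.
exists [ffun i => Ordinal (le_ek i)] => //.
by rewrite mem_filter mem_enum -sum_vec vecE ke eqxx.
Qed.

Lemma size_dsympow k d : d != [::] ->
  size (dsympow k d) = 'C(size d + k - 1, k).
Proof.
case: d => // c d _; rewrite (perm_size (perm_dsympow _ _)) size_map size_expvecs /=.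
by rewrite addSn subn1 -[LHS]bin_sub ?leq_addr // addKn.
Qed.

(** * Symmetric powers from exterior powers *)

(** A sequence F of diagonal forms stands for the series of the F k t^k. Then
    [twist c] is the multiplication by 1 + c t and [evenly] the division by
    1 - t^2. *)
Definition twist c F k : seq K :=
  F k ++ if k is k'.+1 then dscale c (F k') else [::].

Fixpoint evenly F k : seq K :=
  if k is k'.+2 then F k ++ evenly F k' else F k.

Definition unit_form k : seq K := if k is 0 then [:: 1] else [::].

Definition extpow d : nat -> seq K := foldr twist unit_form d.

Lemma nat_ind2 (P : nat -> Prop) :
  P 0%N -> P 1%N -> (forall k, P k -> P k.+2) -> forall k, P k.
Proof.
move=> P0 P1 PS k; suff [] : P k /\ P k.+1 by [].
by elim: k => [|k [Pk Pk1]]; split=> //; apply: PS.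
Qed.

Lemma evenly_twist c F k :
  perm_eq (evenly (twist c F) k) (twist c (evenly F) k).
Proof.
elim/nat_ind2: k => [//|//|k IH] /=.
apply/permP => P; move/permP/(_ P): IH; rewrite /twist.
by case: k => [|k]; rewrite /dscale /= ?map_cat !count_cat /=; nat_atoms; lia.
Qed.

Lemma chain_evenly F G : (forall k, chain (F k) (G k)) ->
  forall k, chain (evenly F k) (evenly G k).
Proof. by move=> FG; elim/nat_ind2=> //= k; apply: chain_cat. Qed.

Lemma chain_twist c F G : (forall k, chain (F k) (G k)) ->
  forall k, chain (twist c F k) (twist c G k).
Proof.
move=> FG [|k]; apply: chain_cat (FG _) _; first exact: chain_refl.
exact: chain_scale.
Qed.

Lemma chain_iter_evenly N F G : (forall k, chain (F k) (G k)) ->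
  forall k, chain (iter N evenly F k) (iter N evenly G k).
Proof. by move=> FG; elim: N => //= N IH; apply: chain_evenly. Qed.

Lemma sympow_nil : forall k, sympow [::] k = unit_form k.
Proof. by case=> //=; rewrite /sympow /= /monomial /= big_nil. Qed.

Lemma monomial_cons c d i (e : seq nat) :
  monomial (c :: d) (i :: e) = c ^+ i * monomial d e.
Proof. by rewrite /monomial /= big_cons. Qed.

(** The monomials of degree k + 2 in which the first variable has exponent at
    least 2 are those of degree k, up to the square c ^+ 2; the others have
    exponent 0 or 1 and make up [twist c]. *)
Lemma sympow_cons c d k : c != 0 ->
  chain (sympow (c :: d) k) (evenly (twist c (sympow d)) k).
Proof.
move=> c0.
have symE k' : sympow (c :: d) k' =
    flatten [seq dscale (c ^+ i) (sympow d (k' - i)%N) | i <- iota 0 k'.+1].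
  rewrite /sympow [size (c :: d)]/= expvecsS map_flatten -map_comp; congr flatten.
  apply: eq_map => i /=.
  by rewrite /dscale -!map_comp; apply: eq_map => e /=; rewrite monomial_cons.
elim/nat_ind2: k => [||k IH].
- by rewrite symE /= /twist /= expr0 dscale1 cats0; apply: chain_refl.
- by rewrite symE /= /twist /= expr0 dscale1 expr1 cats0; apply: chain_refl.
have -> : sympow (c :: d) k.+2 = twist c (sympow d) k.+2 ++
    dscale (1 * c ^+ 2) (sympow (c :: d) k).
  rewrite (symE k.+2).
  have -> : iota 0 k.+3 = [:: 0, 1 & map (addn 2) (iota 0 k.+1)]%N.
    by rewrite -iotaDl.
  rewrite symE.
  move: (iota 0 k.+1) => I.
  rewrite /= expr0 dscale1 expr1 subn0 subn1 -catA mul1r -map_comp.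
  do 2 congr (_ ++ _).
  rewrite /dscale map_flatten -map_comp; congr flatten; apply: eq_map => i /=.
  by rewrite !subSS -map_comp; apply: eq_map => x /=; rewrite exprD mulrA.
apply: chain_cat2l; apply: chain_trans IH; rewrite -[X in chain _ X]dscale1.
exact: chain_dscale_square.
Qed.

(** All the factors 1 / (1 - t^2) can be pulled out, as they commute with the
    factors 1 + c t. *)
Lemma sympow_extpow d k : all (fun c => c != 0) d ->
  chain (sympow d k) (iter (size d) evenly (extpow d) k).
Proof.
elim: d k => [|c d IH] k /=; first by rewrite sympow_nil => _; apply: chain_refl.
move=> /andP[c0 /IH{}IH]; apply: chain_trans (sympow_cons _ _ c0) _.
apply: chain_evenly => {}k; apply: chain_trans (chain_twist c (fun k => IH k) k) _.
elim: (size d) k => [|N IHN] k /=; first exact: chain_refl.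
apply: chain_trans (chain_sym (chain_perm (evenly_twist _ _ _))) _.
exact: chain_evenly.
Qed.

(** In the binary move, (1 + a t) (1 + b t) = 1 + (a + b) t + a b t^2: the middle
    term changes by isometric planes, and a b only by the square c ^+ 2. *)
Lemma chain_extpow d e : chain d e -> forall k, chain (extpow d k) (extpow e k).
Proof.
elim=> {d e} [d | d e _ IH | d e f _ IHd _ IHe | c d e _ IH | a u d u0
             | a b u v c d cE c0] k.
- exact: chain_refl.
- exact: chain_sym.
- exact: chain_trans (IHd k) (IHe k).
- exact: chain_twist.
- apply: chain_cat; first exact: chain_refl; case: k => [|k]; first exact: chain_refl.
  exact/chain_sym/chain_dscale_square.
rewrite /=; move: (extpow d) => F.
have twist2 x y k' : perm_eq (twist x (twist y F) k'.+1)
    (F k'.+1 ++ (dscale x (F k') ++ dscale y (F k')) ++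
      if k' is k''.+1 then dscale (x * y) (F k'') else [::]).
  apply/permP => P; rewrite /twist; case: k' => [|k'].
    by rewrite !count_cat /= ?cats0; nat_atoms; lia.
  rewrite !dscale_cat dscale_dscale !count_cat; nat_atoms; lia.
case: k => [|k]; first exact: chain_refl.
apply: chain_trans (chain_perm (twist2 _ _ _)) _.
apply: chain_trans (chain_sym (chain_perm (twist2 _ _ _))); apply: chain_cat2l.
apply: chain_cat; first exact: chain_dscale_binary cE c0.
case: k => [|k]; first exact: chain_refl.
have -> : c * (a * b * c) = a * b * c ^+ 2 by ring.
exact/chain_sym/chain_dscale_square.
Qed.

Lemma chain_sympow d e k : all (fun c => c != 0) d -> chain d e ->
  chain (sympow d k) (sympow e k).
Proof.
move=> d0 de; have e0 : all (fun c => c != 0) e by rewrite -(chain_neq0 de).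
apply: chain_trans (sympow_extpow k d0) _; apply: chain_sym.
apply: chain_trans (sympow_extpow k e0) _; rewrite -(chain_size de).
exact/chain_iter_evenly/chain_extpow/chain_sym.
Qed.

Lemma twist_neq0 c F : c != 0 -> (forall k, all (fun c => c != 0) (F k)) ->
  forall k, all (fun c => c != 0) (twist c F k).
Proof.
move=> c0 F0 [|k]; rewrite /twist all_cat F0 //= all_map.
by apply: sub_all (F0 k) => x x0 /=; rewrite mulf_neq0.
Qed.

Lemma evenly_neq0 F : (forall k, all (fun c => c != 0) (F k)) ->
  forall k, all (fun c => c != 0) (evenly F k).
Proof. by move=> F0; elim/nat_ind2=> //= k; rewrite all_cat F0. Qed.

Lemma sympow_neq0 d k : all (fun c => c != 0) d ->
  all (fun c => c != 0) (sympow d k).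
Proof.
elim: d k => [|c d IH] k /=.
  by rewrite sympow_nil; case: k => //= _; rewrite oner_eq0.
move=> /andP[c0 d0]; rewrite (chain_neq0 (sympow_cons d k c0)).
by apply/evenly_neq0/twist_neq0 => // {}k; apply: IH.
Qed.

(** The recursion coming from the formula 1 / (1 - c t). *)
Lemma evenly_twistS c F k : c != 0 ->
  chain (evenly (twist c F) k.+1) (F k.+1 ++ dscale c (evenly (twist c F) k)).
Proof.
move=> c0; elim: k => [|k IH].
  by rewrite /= /twist cats0; apply: chain_refl.
rewrite [evenly _ _]/= -catA; apply: chain_cat2l.
apply: chain_trans (chain_sym (chain_scale c IH)).
rewrite dscale_cat; apply: chain_cat2l; rewrite dscale_dscale -expr2 -[c ^+ 2]mul1r.
apply: chain_sym; apply: chain_trans (chain_dscale_square _ _ c0) _.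
by rewrite dscale1; apply: chain_refl.
Qed.

(** * Forms modulo hyperbolic planes *)

(** Witt equivalence with a direction: hyperbolic planes are only removed from
    the left-hand side. Being transitive and additive, it spares the cancellation
    of planes at the end of a computation. *)
Definition hyp_reduces d e : Prop :=
  exists h, chain d (e ++ dcopies h (hyperbolic_plane K)).

Lemma dcopiesD r s d : dcopies (r + s) d = dcopies r d ++ dcopies s d.
Proof. by rewrite /dcopies nseqD flatten_cat. Qed.

Lemma size_dcopies r d : size (dcopies r d) = (r * size d)%N.
Proof. by elim: r => //= r; rewrite size_cat mulSn => ->. Qed.

Lemma hyp_reduces_chain d e : chain d e -> hyp_reduces d e.
Proof. by exists 0%N; rewrite cats0. Qed.

Lemma hyp_reduces_refl d : hyp_reduces d d.
Proof. exact/hyp_reduces_chain/chain_refl. Qed.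

Lemma hyp_reduces_trans d e f :
  hyp_reduces d e -> hyp_reduces e f -> hyp_reduces d f.
Proof.
move=> [r de] [s ef]; exists (s + r)%N; apply: chain_trans de _.
by rewrite dcopiesD catA; apply: chain_cat2r.
Qed.

Lemma hyp_reduces_cat d d' e e' : hyp_reduces d d' -> hyp_reduces e e' ->
  hyp_reduces (d ++ e) (d' ++ e').
Proof.
move=> [r dd] [s ee]; exists (r + s)%N; apply: chain_trans (chain_cat dd ee) _.
by rewrite dcopiesD; apply/chain_perm/permP => P; rewrite !count_cat; lia.
Qed.

Lemma hyp_reduces_evenly F G : (forall k, hyp_reduces (F k) (G k)) ->
  forall k, hyp_reduces (evenly F k) (evenly G k).
Proof. by move=> FG; elim/nat_ind2=> //= k; apply: hyp_reduces_cat. Qed.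

Lemma count_dcopies P r d : count P (dcopies r d) = (r * count P d)%N.
Proof. by elim: r => //= r; rewrite count_cat mulSn => ->. Qed.

(** The binomials are the coefficients of (1 - t^2)^-(N + 1). *)
Lemma count_iter_evenly P N F j :
  count P (iter N.+1 evenly F j.*2) =
  (\sum_(i < j.+1) 'C(N + (j - i), N) * count P (F i.*2))%N.
Proof.
elim: N j => [|N IHN].
  elim=> [|j IH]; first by rewrite big_ord_recl big_ord0 mul1n addn0.
  rewrite -[iter _ _ _ _]/(F j.+1.*2 ++ iter 1 evenly F j.*2) count_cat IH addnC.
  rewrite [in RHS]big_ord_recr /= bin0 mul1n.
  by congr (_ + _)%N; apply: eq_bigr => i _; rewrite !bin0.
elim=> [|j IH].
  by move: (IHN 0%N); rewrite !big_ord_recl !big_ord0 /= subn0 !addn0 !binn.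
rewrite -[iter _ _ _ _]/(iter N.+1 evenly F j.*2.+2 ++ iter N.+2 evenly F j.*2).
rewrite count_cat IH -doubleS IHN big_ord_recr [in RHS]big_ord_recr /=.
rewrite subnn !addn0 !binn addnAC; congr (_ + _)%N.
rewrite -big_split; apply: eq_bigr => i _ /=; rewrite -mulnDl; congr (_ * _)%N.
by rewrite subSn -1?ltnS // !addSn !addnS binS addnC.
Qed.

Lemma hyp_reduces_dcopies r d e : hyp_reduces d e ->
  hyp_reduces (dcopies r d) (dcopies r e).
Proof.
move=> de; elim: r => [|r]; first exact: hyp_reduces_refl.
exact: hyp_reduces_cat.
Qed.

Lemma hyperbolic_neq0 m : all (fun c => c != 0) (dcopies m (hyperbolic_plane K)).
Proof. by elim: m => //= m; rewrite oppr_eq0 oner_neq0. Qed.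

Hypothesis two_neq0 : 2%:R != 0 :> K.

Lemma hyp_reduces_pair x u : x != 0 -> u != 0 ->
  hyp_reduces [:: x; - (x * u ^+ 2)] [::].
Proof.
move=> x0 u0; exists 1%N; rewrite /dcopies /= /hyperbolic_plane.
rewrite -mulNr; apply: chain_trans (chain_cons _ (chain_sym (chain_square _ _ u0))) _.
apply: (chain_trans (e := [:: 1; -1 * x ^+ 2]));
  last exact/chain_cons/chain_sym/chain_square.
have -> : -1 * x ^+ 2 = x * - x * 1 by ring.
(* the squares of (1 + 1/x)/2 and (1 - 1/x)/2 differ by 1/x *)
apply: (@chain_binary _ _ _ ((1 + x^-1) / 2%:R) ((1 - x^-1) / 2%:R));
  last exact: oner_neq0.
by field; rewrite x0 two_neq0.
Qed.

Lemma hyp_reduces_opp d : all (fun c => c != 0) d ->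
  hyp_reduces (dscale (-1) d ++ dscale 1 d) [::].
Proof.
elim: d => [_|c d IH /= /andP[c0 /IH{}IH]]; first exact: hyp_reduces_refl.
apply: hyp_reduces_trans (hyp_reduces_cat (hyp_reduces_pair c0 (oner_neq0 _)) IH).
apply/hyp_reduces_chain/chain_perm/permP => P.
rewrite !count_cat /= !count_cat /= mulN1r mul1r expr1n mulr1; nat_atoms; lia.
Qed.

(** With g = F / (1 + t), where F is the series of d, the series at hand is
    g / (1 - t). By the one-step recursion for g, each coefficient of (1 + t) g
    is that of F plus a form <1, -1> g_k, so g / (1 - t) = (1 + t) g / (1 - t^2)
    reduces to F / (1 - t^2). *)
Lemma sympow_hyperbolic_plane d k : all (fun c => c != 0) d ->
  hyp_reduces (sympow (hyperbolic_plane K ++ d) k) (evenly (sympow d) k).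
Proof.
move=> d0; have N0 : -1 != 0 :> K by rewrite oppr_eq0 oner_neq0.
pose g := evenly (twist (-1) (sympow d)).
have g0 k' : all (fun c => c != 0) (g k').
  by apply/evenly_neq0/twist_neq0 => // {}k; apply: sympow_neq0.
apply: (hyp_reduces_trans (e := evenly (twist 1 g) k)).
  apply/hyp_reduces_chain/(chain_trans (sympow_cons _ _ (oner_neq0 _))).
  by apply/chain_evenly/chain_twist => {}k; apply: sympow_cons.
have step k' : hyp_reduces (twist 1 g k'.+1) (sympow d k'.+1).
  apply: (hyp_reduces_trans (hyp_reduces_chain (chain_cat2r _ (evenly_twistS _ _ N0)))).
  rewrite -catA -[X in hyp_reduces _ X]cats0.
  exact: hyp_reduces_cat (hyp_reduces_refl _) (hyp_reduces_opp (g0 _)).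
apply: hyp_reduces_evenly k => -[|k]; last exact: step.
by rewrite /twist /g /= /twist !cats0; apply: hyp_reduces_refl.
Qed.

Lemma sympow_hyperbolic m d k : all (fun c => c != 0) d ->
  hyp_reduces (sympow (dcopies m (hyperbolic_plane K) ++ d) k)
    (iter m evenly (sympow d) k).
Proof.
move=> d0; elim: m k => [|m IH] k; first exact: hyp_reduces_refl.
apply: hyp_reduces_trans (hyp_reduces_evenly IH k).
by apply: sympow_hyperbolic_plane; rewrite all_cat hyperbolic_neq0.
Qed.

(** The form q = <t><1, a, b, - u^2 a b> has discriminant - u^2 up to squares. Its
    six products of two coefficients fall into three pairs x, - x v^2, since
    complementary pairs of coefficients have product - u^2 up to squares; so only
    the exterior powers of degrees 0 and 4 survive. The binomials are written with
    the lower index m + 3 so that the last one vanishes for j = 1. *)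
Lemma sympow_quaternary m j t a b u : (0 < j)%N ->
    t != 0 -> a != 0 -> b != 0 -> u != 0 ->
  let q := dscale t [:: 1; a; b; - u ^+ 2 * a * b] in
  hyp_reduces (sympow (dcopies m (hyperbolic_plane K) ++ q) j.*2)
   (dcopies 'C(m + 3 + j, m + 3) [:: 1] ++
    dcopies 'C(m + 1 + j, m + 3) [:: - u ^+ 2]).
Proof.
move=> j0 t0 a0 b0 u0 q.
have q0 : all (fun c => c != 0) q.
  by rewrite /q /= !mulf_neq0 ?oppr_eq0 ?expf_neq0 ?oner_neq0.
apply: hyp_reduces_trans (sympow_hyperbolic m _ q0) _.
have ext : chain (iter m evenly (sympow q) j.*2)
    (iter (m + 3).+1 evenly (extpow q) j.*2).
  rewrite -addnS iterD; apply: chain_iter_evenly => k.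
  exact: sympow_extpow.
apply: hyp_reduces_trans (hyp_reduces_chain ext) _.
have ext0 i : (2 < i)%N -> extpow q i.*2 = [::] by case: i => [|[|[]]].
apply: (hyp_reduces_trans (e := dcopies 'C(m + 3 + j, m + 3) (extpow q 0) ++
    dcopies 'C(m + 2 + j, m + 3) (extpow q 2) ++
    dcopies 'C(m + 1 + j, m + 3) (extpow q 4))).
  apply/hyp_reduces_chain/chain_perm/permP => P.
  rewrite count_iter_evenly !count_cat !count_dcopies.
  case: j j0 {ext} => [//|[_|j _]].
    rewrite !big_ord_recl big_ord0 (@bin_small (m + 1 + 1)) ?addn1 ?addn3 //.
    by rewrite [(1 - _)%N]subnn mul0n addn2 !addn0.
  rewrite 3!big_ord_recl big1 ?addn0 => [|i _]; last by rewrite ext0 ?muln0.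
  by rewrite /= /bump /= !subSS !subn0 !addn1 !addn2 !addn3 !addSn !addnS.
apply: hyp_reduces_cat; first exact: hyp_reduces_refl.
rewrite -[X in hyp_reduces _ X]cat0s; apply: hyp_reduces_cat.
  apply: (hyp_reduces_trans (e := dcopies 'C(m + 2 + j, m + 3) [::])); last first.
    by elim: 'C(_, _) => // ; apply: hyp_reduces_refl.
  apply: hyp_reduces_dcopies.
  have pairE x y v : x != 0 -> v != 0 -> y = - (x * v ^+ 2) ->
      hyp_reduces [:: x; y] [::].
    by move=> x0 v0 ->; apply: hyp_reduces_pair.
  have perm6 c0 c1 c2 c3 : perm_eq (extpow [:: c0; c1; c2; c3] 2)
     ([:: c0 * c1; c2 * c3] ++ [:: c0 * c2; c1 * c3] ++ [:: c1 * c2; c0 * c3]).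
    by apply/permP => P; rewrite /= !mulr1; nat_atoms; lia.
  apply: hyp_reduces_trans (hyp_reduces_chain (chain_perm (perm6 _ _ _ _))) _.
  rewrite -[X in hyp_reduces _ X]cat0s; apply: hyp_reduces_cat.
    by apply: (pairE _ _ (u * b)); rewrite ?mulf_neq0 ?oner_neq0 //; ring.
  rewrite -[X in hyp_reduces _ X]cat0s; apply: hyp_reduces_cat.
    by apply: (pairE _ _ (u * a)); rewrite ?mulf_neq0 ?oner_neq0 //; ring.
  by apply: (pairE _ _ u); rewrite ?mulf_neq0 ?oner_neq0 //; ring.
apply/hyp_reduces_dcopies/hyp_reduces_chain.
have -> : extpow q 4 = [:: - u ^+ 2 * (t ^+ 2 * a * b) ^+ 2].
  by congr [:: _]; rewrite /=; ring.
by apply/chain_sym/chain_square; rewrite !mulf_neq0 ?expf_neq0.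
Qed.

End Sympow.

(** * Orthogonal bases *)

Section OrthogonalBasis.
Variables (K : fieldType) (A : vectType K) (B : A -> A -> K).
Hypothesis B_linear : forall c u u' v, B (c *: u + u') v = c * B u v + B u' v.
Hypothesis B_sym : forall u v, B u v = B v u.

Let B0 v : B 0 v = 0.
Proof. by have := B_linear (-1) 0 0 v; rewrite scaler0 addr0 mulN1r addNr. Qed.

Let BD u u' v : B (u + u') v = B u v + B u' v.
Proof. by rewrite -[u]scale1r B_linear mul1r scale1r. Qed.

Let BZ c u v : B (c *: u) v = c * B u v.
Proof. by rewrite -[c *: u]addr0 B_linear B0 addr0. Qed.

Let B_sum I (r : seq I) (F : I -> A) v :
  B (\sum_(i <- r) F i) v = \sum_(i <- r) B (F i) v.
Proof. by apply: (big_morph (B ^~ v)) => // *; apply: BD. Qed.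

Let orthogonal := pairwise (fun u v => B u v == 0).

Let orthogonal_sum N (e : N.-tuple A) (k : 'I_N -> K) (j : 'I_N) : orthogonal e ->
  B (\sum_i k i *: e`_i) e`_j = k j * B e`_j e`_j.
Proof.
move=> /(pairwiseP 0) e_orth; rewrite B_sum (bigD1 j) //= BZ big1 ?addr0 // => i ij.
rewrite BZ; apply/eqP; rewrite mulf_eq0; apply/orP; right.
case: (ltngtP i j) => [ltij|ltji|/val_inj/eqP]; last by rewrite (negPf ij).
  by apply: e_orth => //; rewrite inE size_tuple.
by rewrite B_sym; apply: e_orth => //; rewrite inE size_tuple.
Qed.

Lemma orthogonal_seq_free (es : seq A) :
  orthogonal es -> all (fun c => c != 0) [seq B u u | u <- es] -> free es.
Proof.
move=> es_orth; rewrite all_map => es0; apply/(freeP (X := in_tuple es)) => k k0 j.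
have := orthogonal_sum (e := in_tuple es) k j es_orth; rewrite k0 B0 => /esym/eqP.
by rewrite mulf_eq0 => /orP[/eqP//|]; rewrite (negPf (all_nthP 0 es0 j _)).
Qed.

(** The coordinates on an orthogonal basis provide the isometry. *)
Lemma orthogonal_diagonalization (es : seq A) :
    orthogonal es -> all (fun c => c != 0) [seq B u u | u <- es] ->
    size es = \dim {:A} ->
  diagonalization (fun z => B z z) [seq B u u | u <- es].
Proof.
move=> es_orth es0 dimA; have es_free := orthogonal_seq_free es_orth es0.
split=> //; set d := [seq B u u | u <- es].
have size_d : size es == size d by rewrite size_map.
pose e := Tuple size_d.
have e_basis : basis_of {:A} e by rewrite basisEfree es_free subvf dimA leqnn.
pose f z : 'rV_(size d) := \row_i coord e i z.
have f_lin : linear f by move=> c u v; apply/rowP=> i; rewrite !mxE linearP.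
pose fL : {linear A -> 'rV_(size d)} :=
  HB.pack f (GRing.isLinear.Build _ _ _ _ f f_lin).
exists fL; split=> [|z].
  exists (fun v : 'rV_(size d) => \sum_i v 0 i *: e`_i) => [z | v] /=.
    rewrite [RHS](coord_basis e_basis (memvf z)).
    by apply: eq_bigr => i _; rewrite mxE.
  by apply/rowP=> j; rewrite mxE coord_sum_free.
have zE := coord_basis e_basis (memvf z).
transitivity (B (\sum_i coord e i z *: e`_i) z); last by rewrite -zE.
rewrite B_sum; apply: eq_bigr => i _.
have ies : (i < size es)%N by rewrite (eqP size_d).
rewrite mxE BZ B_sym; set c := coord e i z; rewrite zE orthogonal_sum // -/c.
by rewrite (nth_map 0) //=; ring.
Qed.

Hypothesis two_neq0 : 2%:R != 0 :> K.

(** Here E g is orthogonal to all E h but E (s g). A fixed point g of s gives the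
    vector E g, and a two-element orbit {g, s g} spans a hyperbolic plane, for
    which E g + t E (s g) and E g - t E (s g) have norms 1 and -1. *)
Lemma involution_orthogonal (G : finType) (s : G -> G) (E : G -> A) (F : seq G) :
    involutive s -> uniq F -> (forall g, (g \in F) = (s g == g)) ->
    (forall g h, h != s g -> B (E g) (E h) = 0) ->
    (forall g, B (E g) (E (s g)) != 0) ->
  exists2 es : seq A, orthogonal es &
    [seq B u u | u <- es] = [seq B (E g) (E g) | g <- F] ++
      dcopies ((#|G| - size F) %/ 2) (hyperbolic_plane K).
Proof.
move=> sK F_uniq F_fix E0 E1.
(* one representative of each orbit with two elements *)
pose P := [seq g <- enum {: G} | (enum_rank g < enum_rank (s g))%N].
have P_rank g : (g \in P) = (enum_rank g < enum_rank (s g))%N.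
  by rewrite mem_filter mem_enum andbT.
have sP g : g \in P -> s g \notin P by rewrite !P_rank sK; lia.
have P_moved g : g \in P -> s g != g.
  by rewrite P_rank; apply: contraTneq => ->; rewrite ltnn.
have P_size : size P = ((#|G| - size F) %/ 2)%N.
  have : perm_eq (enum {: G}) (F ++ P ++ map s P).
    apply: uniq_perm; rewrite ?enum_uniq //.
      have P_uniq : uniq P by rewrite filter_uniq ?enum_uniq.
      rewrite !cat_uniq F_uniq P_uniq (map_inj_uniq (can_inj sK)) P_uniq.
      rewrite andbT /=; apply/andP; split.
        apply/hasPn => g; rewrite mem_cat F_fix.
        move=> /orP[/P_moved//|/mapP[h /P_moved hs ->]].
        by rewrite sK eq_sym.
      by apply/hasPn => _ /mapP[h /sP hs ->].
    move=> g; rewrite mem_enum !mem_cat F_fix P_rank.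
    case: (ltngtP (enum_rank g) (enum_rank (s g))) => [|lt|/val_inj/enum_rank_inj <-];
      rewrite ?orbT ?eqxx //.
    by rewrite -[g in g \in _]sK map_f ?orbT // P_rank sK.
  move=> /perm_size; rewrite -cardT !size_cat (size_map s) => ->.
  by rewrite addKn addnn -muln2 mulnK.
pose t g := (2%:R * B (E g) (E (s g)))^-1.
pose pair g := [:: E g + t g *: E (s g); E g + - t g *: E (s g)].
have BDr u v v' : B u (v + v') = B u v + B u v' by rewrite B_sym BD !(B_sym u).
have BZr c u v : B u (c *: v) = c * B u v by rewrite B_sym BZ B_sym.
have Es g h : h != g -> B (E (s g)) (E h) = 0 by move=> hg; apply: E0; rewrite sK.
have pair_norm g : s g != g ->
    [seq B u u | u <- pair g] = hyperbolic_plane K /\ orthogonal (pair g).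
  move=> gs; have gs' : g != s g by rewrite eq_sym.
  have nz : 2%:R * B (E g) (E (s g)) != 0 by rewrite mulf_neq0.
  rewrite /orthogonal /= !(BD, BDr, BZ, BZr) (E0 g g) // (Es g (s g)) //.
  rewrite (B_sym (E (s g)) (E g)) /t /hyperbolic_plane; split.
    by congr [:: _; _]; field; rewrite E1 two_neq0.
  by rewrite !andbT; apply/eqP; field; rewrite E1 two_neq0.
have orth g h c c' : h != g -> h != s g ->
    B (E g + c *: E (s g)) (E h + c' *: E (s h)) = 0.
  move=> hg hsg; rewrite !(BD, BDr, BZ, BZr) (E0 g h) // !Es //.
    by rewrite E0 ?(inj_eq (can_inj sK)) // !mulr0 !addr0.
  by apply: contraNneq hsg => <-; rewrite sK.
have mem_pair g u : u \in pair g -> exists c, u = E g + c *: E (s g).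
  by rewrite !inE => /orP[] /eqP->; [exists (t g) | exists (- t g)].
have pairs Q : uniq Q -> {subset Q <= P} ->
    orthogonal (flatten (map pair Q)) /\
    [seq B u u | u <- flatten (map pair Q)] =
      dcopies (size Q) (hyperbolic_plane K).
  elim: Q => [//|g Q IH] /andP[gQ /IH{}IH] gQP.
  have gP : g \in P by apply: gQP; rewrite mem_head.
  have QP : {subset Q <= P} by move=> h hQ; apply: gQP; rewrite inE hQ orbT.
  have [Q_orth Q_norm] := IH QP; have [g_norm g_orth] := pair_norm g (P_moved g gP).
  split; last by rewrite map_cat g_norm Q_norm.
  rewrite /orthogonal pairwise_cat; apply/and3P; split=> //.
  apply/allrelP => u v /mem_pair[c ->] /flatten_mapP[h hQ /mem_pair[c' ->]].
  apply/eqP/orth; first by apply: contraNneq gQ => <-.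
  by apply: contraTneq (QP h hQ) => ->; apply: sP.
have [|//|P_orth P_norm] := pairs P _ _; first by rewrite filter_uniq ?enum_uniq.
exists ([seq E g | g <- F] ++ flatten (map pair P)).
  rewrite /orthogonal pairwise_cat; apply/and3P; split=> //.
    apply/allrelP => _ v /mapP[g gF ->] /flatten_mapP[h hP /mem_pair[c ->]].
    have sg : s g = g by apply/eqP; rewrite -F_fix.
    have hg : h != g by apply: contraTneq hP => ->; rewrite P_rank sg ltnn.
    by rewrite -[E g]addr0 -(scale0r (E (s g))) orth // sg.
  suff fixed Q : uniq Q -> {subset Q <= F} -> orthogonal [seq E g | g <- Q].
    exact: fixed.
  rewrite /orthogonal; elim: Q => //= g Q IH /andP[gQ /IH{}IH] QF.
  rewrite IH ?andbT => [|h hQ]; last by apply: QF; rewrite inE hQ orbT.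
  apply/allP => _ /mapP[h hQ ->]; apply/eqP/E0.
  have /eqP-> : s g == g by rewrite -F_fix QF ?mem_head.
  by apply: contraNneq gQ => <-.
by rewrite map_cat P_norm P_size -map_comp.
Qed.

End OrthogonalBasis.

(** * The reduced trace *)
Section ReducedTrace.
Variables (K : fieldType) (A : falgType K) (Trd : A -> K).

(** A nonzero trace exists because the images of a basis of A span the matrix
    algebra over L, on which the trace is not zero. *)
Lemma reduced_traceP : reduced_trace Trd ->
  [/\ forall c u v, Trd (c *: u + v) = c * Trd u + Trd v,
      forall u v, Trd (u * v) = Trd (v * u),
      ~ (forall z, Trd z = 0)
    & exists d, \dim {:A} = (d * d)%N /\ Trd 1 = d%:R].
Proof.
case=> L [iota [d [rho [[rhoZ rho_basis] rho_tr]]]].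
have dimA : \dim {:A} = (d * d)%N.
  have /andP[/eqP rho_span /eqP] := rho_basis.
  by rewrite rho_span size_map size_tuple dimvf => <-.
split.
- move=> c u v; apply: (fmorph_inj iota).
  by rewrite rho_tr !rmorphD rmorphM /= !rho_tr rhoZ linearD linearZ.
- by move=> u v; apply: (fmorph_inj iota); rewrite !rho_tr !rmorphM; apply: mxtrace_mulC.
- move=> Trd0; have : d != 0%N.
    apply: contraTneq isT => d0; move: dimA.
    rewrite d0 => /eqP; rewrite dimv_eq0 => /eqP A0.
    by have := memvf (1 : A); rewrite A0 memv0 oner_eq0.
  case: d rho rhoZ rho_basis rho_tr {dimA} => // d rho _ rho_basis rho_tr _.
  suff tr0 (N : 'M[L]_d.+1) : \tr N = 0.
    have /eqP := tr0 (delta_mx 0 0); rewrite /mxtrace (bigD1 0) //= mxE eqxx.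
    rewrite big1 => [|i i0]; last by rewrite mxE (negPf i0).
    by rewrite addr0 oner_eq0.
  pose e := map_tuple rho (vbasis {:A}).
  rewrite (coord_basis (X := e) rho_basis (memvf N)) linear_sum big1 // => i _.
  have /mapP[z _ ->] : e`_i \in [seq rho z | z <- vbasis {:A}].
    by rewrite mem_nth // size_tuple.
  by rewrite linearZ /= -rho_tr Trd0 rmorph0 mulr0.
exists d; split=> //; apply: (fmorph_inj iota).
by rewrite rho_tr rmorph1 mxtrace1 rmorph_nat.
Qed.

End ReducedTrace.

(** * Symbol algebras *)
Lemma prim_root_half (K : fieldType) n (w : K) : (0 < n)%N -> ~~ odd n ->
  n.-primitive_root w -> w ^+ (n %/ 2) = -1.
Proof.
move=> n_gt0 n_even w_prim; have n2 : (n %/ 2 * 2 = n)%N by lia.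
have /eqP : (w ^+ (n %/ 2)) ^+ 2 = 1 by rewrite -exprM n2 prim_expr_order.
rewrite sqrf_eq1 => /orP[|/eqP//].
by rewrite -(prim_order_dvd w_prim) gtnNdvd //; lia.
Qed.

Section SymbolAlgebra.
Variables (n : nat) (K : fieldType) (w a b : K) (A : falgType K) (x y : A).
Hypotheses (n_gt0 : (0 < n)%N) (w_prim : n.-primitive_root w).
Hypotheses (a_neq0 : a != 0) (b_neq0 : b != 0).
Hypothesis A_symbol : symbol_algebra n w a b x y.

Let M i j := x ^+ i * y ^+ j.

Lemma symbol_commute i j : y ^+ j * x ^+ i = w ^+ (i * j) *: M i j.
Proof.
have yX : y * x ^+ i = w ^+ i *: (x ^+ i * y).
  elim: i => [|i IH]; first by rewrite !expr0 mulr1 mul1r scale1r.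
  rewrite !exprSr mulrA IH -scalerAl -(mulrA _ y x) (symbol_yx A_symbol).
  by rewrite -scalerAr scalerA mulrA.
elim: j => [|j IH]; first by rewrite /M muln0 !expr0 mulr1 mul1r scale1r.
rewrite exprS -mulrA IH /M -scalerAr mulrA yX -scalerAl scalerA -mulrA -exprS.
by rewrite -exprD mulnS addnC.
Qed.

Lemma symbol_mul i j k l : M i j * M k l = w ^+ (k * j) *: M (i + k) (j + l).
Proof.
rewrite /M mulrA -(mulrA (x ^+ i)) symbol_commute -scalerAr -scalerAl /M.
by rewrite !exprD !mulrA.
Qed.

Lemma symbol_shift k l i j : M (n * k + i) (n * l + j) = (a ^+ k * b ^+ l) *: M i j.
Proof.
rewrite /M !exprD !exprM (symbol_xn A_symbol) (symbol_yn A_symbol).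
by rewrite !exprZn !expr1n -!scalerAl !mul1r -scalerAr scalerA.
Qed.

(** The span of the monomials is stable under left multiplication by x and y,
    hence contains the algebra that they generate. *)
Lemma symbol_span :
  <<[seq M (val p.1) (val p.2) | p : 'I_n * 'I_n]>>%VS = {:A}%VS.
Proof.
set W := span _.
have inW i j : M i j \in W.
  have lt k : (k %% n < n)%N by rewrite ltn_mod.
  rewrite (divn_eq i n) (divn_eq j n) !(mulnC _ n) symbol_shift memvZ //.
  apply: memv_span; apply/mapP.
  by exists (Ordinal (lt i), Ordinal (lt j)); rewrite ?mem_enum.
apply/eqP; rewrite eqEsubv subvf /= -(symbol_gen A_symbol).
apply: agenv_sub_modl; first by rewrite -memvE; have := inW 0%N 0%N; rewrite /M mulr1.
apply/prodvP => u v; rewrite span_def big_cons big_seq1.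
move=> /memv_addP[_ /vlineP[c ->] [_ /vlineP[d ->] ->]].
rewrite mulrDl -!scalerAl => vW.
have stable z : (forall i j, z * M i j \in W) -> z * v \in W.
  move=> zM; have := coord_span vW; move: (coord _) => co ->.
  rewrite mulr_sumr rpred_sum // => i _; rewrite -scalerAr rpredZ //.
  have /mapP[p _ ->] : (in_tuple [seq M (val p.1) (val p.2) | p : 'I_n * 'I_n])`_i
     \in [seq M (val p.1) (val p.2) | p : 'I_n * 'I_n].
    by rewrite mem_nth //= size_image.
  exact: zM.
rewrite rpredD // rpredZ // stable // => i j.
  have := symbol_mul 1 0 i j; rewrite /M expr1 expr0 mulr1 => ->.
  by rewrite rpredZ // inW.
have := symbol_mul 0 1 i j; rewrite /M expr1 expr0 mul1r => ->.
by rewrite rpredZ // inW.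
Qed.

Variable Trd : A -> K.
Hypothesis Trd_red : reduced_trace Trd.

Let Trd_linear c u v : Trd (c *: u + v) = c * Trd u + Trd v.
Proof. by case: (reduced_traceP Trd_red). Qed.

Let TrdC u v : Trd (u * v) = Trd (v * u).
Proof. by case: (reduced_traceP Trd_red). Qed.

Let Trd0 : Trd 0 = 0.
Proof. by have := Trd_linear (-1) 0 0; rewrite scaler0 addr0 mulN1r addNr. Qed.

Let TrdZ c u : Trd (c *: u) = c * Trd u.
Proof. by rewrite -[c *: u]addr0 Trd_linear Trd0 addr0. Qed.

Lemma trd_multiple i j : Trd (M (n * i) (n * j)) = a ^+ i * b ^+ j * Trd 1.
Proof.
rewrite -[(n * i)%N]addn0 -[(n * j)%N]addn0 symbol_shift TrdZ.
by rewrite /M !expr0 mulr1.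
Qed.

(** If n does not divide i, then w ^+ i != 1; comparing the traces of y * z and
    z * y, for z = x ^+ i * y ^+ (j + n - 1), shows that w ^+ i fixes
    Trd (x ^+ i * y ^+ (j + n)), which is b times the trace in question. The
    exponent of y is shifted by n to keep it positive. *)
Lemma trd_monomial_eq0 i j : ~~ ((n %| i) && (n %| j))%N -> Trd (M i j) = 0.
Proof.
have prim k : (n %| k)%N = (w ^+ k == 1) by rewrite (prim_order_dvd w_prim).
have comm k l k' l' : w ^+ (k' * l) * Trd (M (k + k') (l + l')) =
    w ^+ (k * l') * Trd (M (k + k') (l + l')).
  rewrite -TrdZ -symbol_mul TrdC symbol_mul TrdZ [(k' + k)%N]addnC.
  by rewrite [(l' + l)%N]addnC.
have fixed (c t : K) : c * t = t -> c != 1 -> t = 0.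
  move=> ct c1; apply/eqP.
  have /eqP : (c - 1) * t = 0 by rewrite mulrBl ct mul1r subrr.
  by rewrite mulf_eq0 subr_eq0 (negPf c1).
rewrite negb_and !prim => /orP[wi|wj].
  have := comm 0%N 1%N i (n * 1 + j - 1)%N.
  rewrite muln1 mul0n expr0 mul1r add0n subnKC; last by lia.
  move=> /fixed/(_ wi); have := symbol_shift 0 1 i j.
  rewrite muln0 add0n expr0 mul1r expr1 => ->; rewrite TrdZ => /eqP.
  by rewrite mulf_eq0 (negPf b_neq0) => /eqP.
have := comm 1%N 0%N (n * 1 + i - 1)%N j.
rewrite muln0 mul1n expr0 mul1r add0n subnKC; last by lia.
move=> /esym/fixed/(_ wj); have := symbol_shift 1 0 i j.
rewrite muln0 add0n expr0 mulr1 expr1 => ->; rewrite TrdZ => /eqP.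
by rewrite mulf_eq0 (negPf a_neq0) => /eqP.
Qed.

(** Otherwise the reduced trace would vanish on all the monomials. The equality
    Trd 1 = n comes later, as its proof needs this fact. *)
Lemma trd1_neq0 : Trd 1 != 0.
Proof.
have [_ _ Tn0 _] := reduced_traceP Trd_red.
apply/eqP => T0; case: Tn0 => z.
have : z \in <<[seq M (val p.1) (val p.2) | p : 'I_n * 'I_n]>>%VS.
  by rewrite symbol_span memvf.
move=> /coord_span; move: (coord _) => co ->.
rewrite (big_morph Trd (id1 := 0) (op1 := +%R)) // => [|u v]; last first.
  by rewrite -[u in LHS]scale1r Trd_linear mul1r.
apply: big1 => i _; rewrite TrdZ.
have /mapP[p _ ->] : (in_tuple [seq M (val p.1) (val p.2) | p : 'I_n * 'I_n])`_i
     \in [seq M (val p.1) (val p.2) | p : 'I_n * 'I_n].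
  by rewrite mem_nth //= size_image.
have [/andP[/dvdnP[k ->] /dvdnP[l ->]]|/trd_monomial_eq0->] :=
    boolP ((n %| val p.1) && (n %| val p.2))%N; last exact: mulr0.
by rewrite -!(mulnC n) trd_multiple T0 !mulr0.
Qed.

Hypothesis n_even : ~~ odd n.
Hypothesis two_neq0 : 2%:R != 0 :> K.

(** The orthogonal family of [involution_orthogonal] is free, with as many
    members as there are monomials, which span: so it is a basis. As the dimension
    is the square of the degree d of the splitting, d = n and Trd 1 = n. *)
Lemma trace_form_diagonalization :
  diagonalization (trace_form Trd)
    (dscale n%:R [:: 1; a; b; (-1) ^+ (n %/ 2) * a * b] ++
     dcopies ((n ^ 2 - 4) %/ 2) (hyperbolic_plane K)).
Proof.
pose B u v := Trd (u * v).
have B_linear c u u' v : B (c *: u + u') v = c * B u v + B u' v.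
  by rewrite /B mulrDl -scalerAl Trd_linear.
have B_sym u v : B u v = B v u by apply: TrdC.
pose opp (i : 'I_n) : 'I_n := Ordinal (ltn_pmod (n - i) n_gt0).
have oppE i : opp i = (if i == 0 :> nat then 0 else n - i)%N :> nat.
  rewrite /=; case: eqP => [->|i0]; first by rewrite subn0 modnn.
  by rewrite modn_small //; have := ltn_ord i; lia.
have dvd_opp (i k : 'I_n) : (n %| i + k)%N = (k == opp i).
  rewrite -(inj_eq val_inj) /= [X in _ == X]oppE; case: i k => [i ilt] [k klt] /=.
  apply/dvdnP/eqP => [[q]|->]; last by exists (i != 0%N); case: eqP; lia.
  case: q => [|[|q]]; last by rewrite !mulSn; lia.
    by case: eqP; lia.
  by case: eqP; lia.
have opp_mul (i : 'I_n) : exists q, (i + opp i = n * q)%N.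
  have /dvdnP[q ->] : (n %| i + opp i)%N by rewrite dvd_opp.
  by exists q; rewrite mulnC.
have oppK : involutive opp.
  by move=> i; apply/eqP; rewrite eq_sym -dvd_opp addnC dvd_opp.
pose s (g : 'I_n * 'I_n) := (opp g.1, opp g.2).
pose E (g : 'I_n * 'I_n) := M (val g.1) (val g.2).
have sK : involutive s by case=> i j; rewrite /s /= !oppK.
have B_E g h : B (E g) (E h) = w ^+ (h.1 * g.2) * Trd (M (g.1 + h.1) (g.2 + h.2)).
  by rewrite /B symbol_mul TrdZ.
have E0 g h : h != s g -> B (E g) (E h) = 0.
  move=> hg; rewrite B_E trd_monomial_eq0 ?mulr0 //.
  by apply: contra hg; rewrite !dvd_opp -pair_eqE.
have wX0 k : w ^+ k != 0 by rewrite expf_neq0 // (prim_root_eq0 w_prim); lia.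
have E1 g : B (E g) (E (s g)) != 0.
  have [q Eq] := opp_mul g.1; have [q' Eq'] := opp_mul g.2.
  rewrite B_E [Trd _](_ : _ = Trd (M (n * q) (n * q'))); last by rewrite -Eq -Eq'.
  by rewrite trd_multiple !mulf_neq0 ?wX0 ?expf_neq0 ?trd1_neq0.
have half : (n %/ 2 < n)%N by lia.
pose i0 := Ordinal n_gt0; pose h := Ordinal half.
pose F := [:: (i0, i0); (h, i0); (i0, h); (h, h)].
have h0 : h != i0 by rewrite -(inj_eq val_inj) /=; lia.
have F_uniq : uniq F by rewrite /= !inE !xpair_eqE !eqxx (eq_sym i0) (negPf h0).
have F_fix g : (g \in F) = (s g == g).
  have fix1 i : (opp i == i) = (i == i0) || (i == h).
    rewrite -!(inj_eq val_inj) /= [X in X == _]oppE; case: i => i ilt /=.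
    by case: (i == 0%N) /eqP => [->|]; lia.
  case: g => i j; rewrite !inE !xpair_eqE !fix1 /=.
  by case: (i == i0); case: (i == h); case: (j == i0); case: (j == h).
have [es es_orth es_norm] :=
  involution_orthogonal B_linear B_sym two_neq0 sK F_uniq F_fix E0 E1.
rewrite card_prod card_ord in es_norm.
have size_es : size es = (n * n)%N.
  rewrite -(size_map (fun u => B u u)) es_norm size_cat size_map size_dcopies /=.
  have [k nE] : exists k, n = k.*2.+2 by exists (n %/ 2 - 1)%N; lia.
  by rewrite nE; lia.
have hh : (h + h = n)%N.
  by rewrite /=; lia.
have F_norm : [seq B (E g) (E g) | g <- F] =
    dscale (Trd 1) [:: 1; a; b; (-1) ^+ (n %/ 2) * a * b].
  have val00 : Trd (M 0 0) = Trd 1 by rewrite /M !expr0 mulr1.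
  have valn0 : Trd (M n 0) = a * Trd 1.
    by have := trd_multiple 1 0; rewrite muln1 muln0 expr1 expr0 mulr1.
  have val0n : Trd (M 0 n) = b * Trd 1.
    by have := trd_multiple 0 1; rewrite muln1 muln0 expr1 expr0 mul1r.
  have valnn : Trd (M n n) = a * b * Trd 1.
    by have := trd_multiple 1 1; rewrite muln1 !expr1.
  have wh : w ^+ h = -1 := prim_root_half n_gt0 n_even w_prim.
  rewrite /F /dscale /= !B_E !hh !mul0n !muln0 exprM wh expr0 !add0n.
  by rewrite val00 valn0 val0n valnn; congr [:: _; _; _; _]; ring.
have es_norm0 : all (fun c => c != 0) [seq B u u | u <- es].
  rewrite es_norm F_norm all_cat hyperbolic_neq0 andbT /=.
  by rewrite !mulf_neq0 ?trd1_neq0 ?oner_neq0 ?expf_neq0 ?oppr_eq0 ?oner_neq0.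
have dimA : \dim {:A} = (n * n)%N.
  apply/eqP; rewrite eqn_leq -{2}size_es; apply/andP; split.
    have := dim_span [seq M (val p.1) (val p.2) | p : 'I_n * 'I_n].
    by rewrite symbol_span size_image card_prod card_ord.
  rewrite -(eqP (orthogonal_seq_free B_linear B_sym es_orth es_norm0)).
  by rewrite dimvS ?subvf.
have T1 : Trd 1 = n%:R.
  have [_ _ _ [d [dimA' ->]]] := reduced_traceP Trd_red; congr _%:R.
  by apply/esym/eqP; rewrite -eqn_sqr -!mulnn -dimA -dimA'.
rewrite T1 in F_norm; rewrite -mulnn -F_norm -es_norm.
by apply: orthogonal_diagonalization; rewrite ?size_es.
Qed.

End SymbolAlgebra.

(** * Symmetric powers of the trace form *)
Lemma sympow_ratio_bin m j : (1 < j)%N ->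
  sympow_ratio m j.*2 * 'C(m + 1 + j, j - 2)%:R = 'C(m + 3 + j, m + 3)%:R.
Proof.
case: j => [//|[//|j]] _; rewrite /sympow_ratio -muln2 natrM mulfK //.
have -> : 'C(m + 3 + j.+2, m + 3) = 'C(m + 3 + j.+2, j.+2).
  by rewrite -[RHS]bin_sub ?leq_addl // addnK.
have E1 := mul_bin_diag (m + 3 + j.+2) j.+1.
have E2 := mul_bin_diag (m + 2 + j.+2) j.
have E1' : (m + 3 + j.+2)%:R * 'C((m + 3 + j.+2).-1, j.+1)%:R =
  (j.+2)%:R * 'C(m + 3 + j.+2, j.+2)%:R :> rat by rewrite -!natrM E1.
have E2' : (m + 2 + j.+2)%:R * 'C((m + 2 + j.+2).-1, j)%:R =
  (j.+1)%:R * 'C(m + 2 + j.+2, j.+1)%:R :> rat by rewrite -!natrM E2.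
rewrite !subSS subn0 (_ : m + 1 + j.+2 = (m + 2 + j.+2).-1)%N; last by lia.
rewrite (_ : (m + 3 + j.+2).-1 = m + 2 + j.+2)%N in E1'; last by lia.
have j1 : j.+1%:R != 0 :> rat by rewrite Num.Theory.pnatr_eq0.
have j2 : j.+2%:R != 0 :> rat by rewrite Num.Theory.pnatr_eq0.
have jE : j.+2%:R - 1 = j.+1%:R :> rat by rewrite -natr1 addrK.
rewrite jE -!natrD; apply: (mulfI (mulf_neq0 j2 j1)).
transitivity ((m + 3 + j.+2)%:R *
    ((m + 2 + j.+2)%:R * 'C((m + 2 + j.+2).-1, j)%:R) : rat);
  last by rewrite E2' mulrCA E1' mulrCA mulrA.
move: 'C(_.-1, j) => c1.
by field; apply/andP; split; rewrite addrC ?natr1 -?natrD ?addn2 ?j1 ?j2.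
Qed.

Section Final.
Variable K : fieldType.
Hypothesis two_neq0 : 2%:R != 0 :> K.

Lemma hyp_reduces_isometric (r : nat) (d : seq K) :
  hyp_reduces d (nseq r 1) ->
  exists h : nat, (r + 2 * h = size d)%N /\
    isometric (diag_form (d := d))
      (diag_form (d := dcopies r [:: 1] ++ dcopies h (hyperbolic_plane K))).
Proof.
case=> h dh; exists h; split.
  by rewrite (chain_size dh) size_cat size_nseq size_dcopies mulnC.
have <- : nseq r 1 = dcopies r [:: (1 : K)] by elim: r {dh} => //= r ->.
exact/isometric_congruent/congruent_chain.
Qed.

(** The sign (-1) ^ (n / 2) has the form - u^2 in both cases: u = 1 if n / 2 is
    odd, and u = w ^ (n / 4) if it is even. *)
Lemma neg_root_square n (w : K) : (0 < n)%N -> ~~ odd n ->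
  n.-primitive_root w ->
  exists2 u : K, u != 0 &
    (-1) ^+ (n %/ 2) = - u ^+ 2 /\ ((n %% 4 == 0)%N = (u ^+ 2 == -1)).
Proof.
move=> n0 n_even w_prim; have wn2 := prim_root_half n0 n_even w_prim.
have N1 : 1 != -1 :> K by rewrite -subr_eq0 opprK.
have [n4|n4] := eqVneq (n %% 4)%N 0%N.
  exists (w ^+ (n %/ 4)).
    by rewrite expf_neq0 // (prim_root_eq0 w_prim); lia.
  have -> : w ^+ (n %/ 4) ^+ 2 = -1 by rewrite -exprM -wn2; congr (_ ^+ _); lia.
  by rewrite eqxx opprK -signr_odd (_ : odd (n %/ 2) = false) //; lia.
exists 1; first exact: oner_neq0.
by rewrite expr1n (negPf N1) -signr_odd (_ : odd (n %/ 2)) //; lia.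
Qed.

Lemma sympow_trace_form n (a b w : K) : (0 < n)%N -> ~~ odd n ->
    n.-primitive_root w -> n%:R != 0 :> K -> a != 0 -> b != 0 ->
  let q := dscale n%:R [:: 1; a; b; (-1) ^+ (n %/ 2) * a * b] in
  let m := ((n ^ 2 - 4) %/ 2)%N in
  forall k, ~~ odd k -> (1 < k)%N ->
  exists2 r : nat, r%:R = sympow_mult n m k &
   hyp_reduces (sympow (dcopies m (hyperbolic_plane K) ++ q) k) (nseq r 1).
Proof.
move=> n0 n_even w_prim nK a0 b0 q m k k_even k1.
have [u u0 [uE n4]] := neg_root_square n0 n_even w_prim.
pose j := k./2; have kE : k = j.*2 by rewrite /j; lia.
have j0 : (0 < j)%N by rewrite /j; lia.
have redq := sympow_quaternary two_neq0 m j0 nK a0 b0 u0.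
rewrite {}kE /sympow_mult n4 doubleK.
have copies1 (c : K) r : nseq r c = dcopies r [:: c] by elim: r => //= r ->.
rewrite -!copies1 in redq.
have le_r : ('C(m + 1 + j, m + 3) <= 'C(m + 3 + j, m + 3))%N.
  by apply: leq_bin2l; lia.
have multE (s : rat) : (1 < j)%N ->
    (sympow_ratio m j.*2 + s) * 'C(m + 1 + j, j - 2)%:R =
    'C(m + 3 + j, m + 3)%:R + s * 'C(m + 1 + j, m + 3)%:R.
  move=> j1; rewrite mulrDl sympow_ratio_bin //; congr (_ + _ * _%:R).
  by rewrite -[LHS]bin_sub; [congr 'C(_, _) |]; lia.
have mult1 : j = 1%N -> 'C(m + 3 + j, m + 3)%:R = m%:R + 4%:R :> rat /\
    'C(m + 1 + j, m + 3) = 0%N.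
  move=> ->; rewrite addn1 binSn bin_small; last by lia.
  by rewrite -addnS natrD.
have [u2|u2] := eqVneq (u ^+ 2) (-1).
  exists ('C(m + 3 + j, m + 3) + 'C(m + 1 + j, m + 3))%N.
    have [j1|j1] := eqVneq j.*2 2%N.
      by have [E ->] := mult1 ltac:(lia); rewrite addn0.
    by rewrite [1 + _]addrC multE ?mul1r ?natrD //; lia.
  by rewrite /q uE nseqD; rewrite u2 opprK in redq *.
exists ('C(m + 3 + j, m + 3) - 'C(m + 1 + j, m + 3))%N.
  have [j1|j1] := eqVneq j.*2 2%N.
    by have [E ->] := mult1 ltac:(lia); rewrite subn0.
  by rewrite multE ?mulN1r ?natrB //; lia.
have uN : - u ^+ 2 = -1.
  move: u2 uE; rewrite -signr_odd -[_ == _](inj_eq oppr_inj) opprK.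
  by case: odd => [_ <-|/eqP u2 /esym].
rewrite /q uE uN; rewrite uN in redq; apply: hyp_reduces_trans redq _.
have {1}<- := subnK le_r; set s := 'C(m + 1 + j, m + 3).
rewrite nseqD -catA -[X in hyp_reduces _ X]cats0.
apply: (hyp_reduces_cat (hyp_reduces_refl _)).
have d0 : all (fun c : K => c != 0) (nseq s 1) by rewrite all_nseq oner_neq0 orbT.
apply: hyp_reduces_trans (hyp_reduces_opp two_neq0 d0).
apply/hyp_reduces_chain/chain_perm/permP => P.
by rewrite !count_cat /dscale !map_nseq !mulr1 addnC.
Qed.

End Final.

Theorem proposition4p4 (n : nat) (n_gt0 : (0 < n)%N) (n_even : ~~ odd n)
    (K : fieldType) (charK : 2%N \notin [pchar K])
    (w : K) (w_prim : n.-primitive_root w)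
    (a b : K) (a_neq0 : a != 0) (b_neq0 : b != 0)
    (S : falgType K) (x y : S) (S_symbol : symbol_algebra n w a b x y)
    (Trd : S -> K) (Trd_red : reduced_trace Trd) :
  let T_S := trace_form Trd in
  let q_S := dscale n%:R [:: 1; a; b; (-1) ^+ (n %/ 2) * a * b] in
  let m := ((n ^ 2 - 4) %/ 2)%N in
  diagonalization T_S (q_S ++ dcopies m (hyperbolic_plane K)) /\
  forall k : nat, ~~ odd k -> (1 < k)%N ->
  forall d : seq K, diagonalization T_S d ->
  exists r h : nat,
    [/\ r%:R = sympow_mult n m k,
        (r + 2 * h = 'C(n ^ 2 + k - 1, k))%N
      & isometric (diag_form (d := dsympow k d))
          (diag_form (d := dcopies r [:: 1] ++
                           dcopies h (hyperbolic_plane K)))].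
Proof.
move=> T_S q_S m.
have two_neq0 : 2%:R != 0 :> K by move: charK; rewrite inE.
have nK : n%:R != 0 :> K := prim_root_natf_neq0 w_prim.
have T_diag := trace_form_diagonalization n_gt0 w_prim a_neq0 b_neq0 S_symbol
  Trd_red n_even two_neq0.
split=> // k k_even k_gt1 d [d_neq0 d_iso].
have [T_neq0 T_iso] := T_diag.
have chain_d : chain d (dcopies m (hyperbolic_plane K) ++ q_S).
  apply: chain_trans (chain_perm (permEl (perm_catC _ _))).
  apply: chain_congruent => //.
  exact: diagonalization_congruent d_iso T_iso.
have [r r_mult r_red] :=
  sympow_trace_form two_neq0 n_gt0 n_even w_prim nK a_neq0 b_neq0 k_even k_gt1.
have {}r_red : hyp_reduces (dsympow k d) (nseq r 1).
  apply: hyp_reduces_trans r_red; apply: hyp_reduces_chain.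
  apply: chain_trans (chain_perm (perm_dsympow k d)) _.
  exact: chain_sympow.
have [h [size_h iso_h]] := hyp_reduces_isometric r_red.
have n_ge2 : exists j, n = j.*2.+2 by exists (n %/ 2 - 1)%N; lia.
have size_d : size d = (n ^ 2)%N.
  rewrite (chain_size chain_d) size_cat size_dcopies size_map /m.
  by case: n_ge2 => j ->; rewrite -mulnn /=; lia.
have d_neq_nil : d != [::].
  by apply: contraTneq n_gt0 => d_nil; move: size_d; rewrite d_nil /= -mulnn; lia.
exists r, h; split=> //.
by rewrite size_h size_dsympow // size_d.
Qed.
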